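(* Suppose that $y:\mathbb{R}\times(0,T)\to(0,\infty)$ is a positive (smooth) solution of graphical curve shortening flow $y_t=\frac{y_{xx}}{1+y_x^2}$. Then for all $t\in(0,T)$ and all $x\in\mathbb{R}$, we have $$|y_x|\leq\frac{1}{\tan\mathcal{A}_0(t^{-1/2}y)}\equiv\tan\mathcal{A}_1(t^{-1/2}y)\equiv\tan\mathcal{A}_0\big(W(t^{-1/2}y)\big)$$ at $(x,t)$.
   Context: Definition of $W$: for locally Lipschitz $u_0:\mathbb{R}\to\mathbb{R}$ there is a unique continuous $u:\mathbb{R}\times[0,\infty)\to\mathbb{R}$, smooth and solving $u_t=\frac{u_{xx}}{1+u_x^2}$ on $\mathbb{R}\times(0,\infty)$, with $u(\cdot,t)\to u_0=u(\cdot,0)$ locally uniformly as $t\downarrow0$ (Ecker-Huisken, Chou-Zhu). Take $u_0(x)=|x|$. The image of the graph of $u(\cdot,1)$ under clockwise rotation by $\frac{\pi}{4}$ about the origin is the graph of a function $W:(0,\infty)\to(0,\infty)$; equivalently, $W$ is the time-$1$ slice of the self-similar curve shortening flow starting from the union of the non-negative $x$-axis and the positive $y$-axis. $W$ is a decreasing convex diffeomorphism of $(0,\infty)$ with $W^{-1}=W$ and $\int_0^\infty W=\frac{\pi}{2}$, and $\mathcal{W}(x,t):=t^{1/2}W(xt^{-1/2})$ solves $y_t=\frac{y_{xx}}{1+y_x^2}$. Define $\sigma,\mathcal{A}_0,\mathcal{A}_1:(0,\infty)\to(0,\frac{\pi}{2})$ by $\sigma(x):=\int_x^\infty W(s)\,ds$,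 $\mathcal{A}_0(x):=\frac12 xW(x)+\sigma(x)$, and $\mathcal{A}_1(x):=\frac{\pi}{2}-\mathcal{A}_0(x)=\mathcal{A}_0(W(x))$. *)

(* Defs.v *)
From Stdlib Require Import Reals.
From Coquelicot Require Import Coquelicot.
Open Scope R_scope.

(** Functions on a strip [R x (a,b)] or on [(0,oo)] are represented by total
    functions; every predicate below only constrains their values on the
    intended domain. The bounds of the open time interval are in [Rbar]. *)

(** [y_x], [y_xx] and [y_t] at [(x, t)]. *)
Definition dx (y : R -> R -> R) (x t : R) : R := Derive (fun z => y z t) x.
Definition dxx (y : R -> R -> R) (x t : R) : R := Derive_n (fun z => y z t) 2 x.
Definition dt (y : R -> R -> R) (x t : R) : R := Derive (fun s => y x s) t.

(** [ex_diff_n y n x t] says that all iterated partial derivatives of order at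
    most [n] exist and are (jointly) continuous at [(x, t)]. *)
Definition smooth_on_strip (T : Rbar) (y : R -> R -> R) : Prop :=
  forall x t : R, 0 < t -> Rbar_lt t T -> forall n : nat, ex_diff_n y n x t.

Definition graphical_csf (T : Rbar) (y : R -> R -> R) : Prop :=
  smooth_on_strip T y /\
  forall x t : R, 0 < t -> Rbar_lt t T ->
    dt y x t = dxx y x t / (1 + dx y x t ^ 2).

Definition locally_uniform_at_0 (u : R -> R -> R) (u0 : R -> R) : Prop :=
  forall K eps : R, 0 < eps ->
    at_right 0 (fun t => forall x, Rabs x <= K -> Rabs (u x t - u0 x) < eps).

Definition csf_from (u0 : R -> R) (u : R -> R -> R) : Prop :=
  continuous_on (fun p : R * R => 0 <= snd p) (fun p => u (fst p) (snd p)) /\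
  graphical_csf p_infty u /\
  locally_uniform_at_0 u u0 /\
  forall x : R, u x 0 = u0 x.

(** [u] is _the_ flow starting from [u0] (a definite description; agreement is
    only required on the domain [R x [0,oo)]). *)
Definition the_csf_from (u0 : R -> R) (u : R -> R -> R) : Prop :=
  csf_from u0 u /\
  forall v : R -> R -> R, csf_from u0 v ->
    forall x t : R, 0 <= t -> v x t = u x t.

Definition rotate_clockwise (theta : R) (p : R * R) : R * R :=
  (cos theta * fst p + sin theta * snd p,
   - sin theta * fst p + cos theta * snd p).

(** [W : (0,oo) -> (0,oo)] is the function whose graph is the rotated graph of
    [u(.,1)], where [u] is the flow from [|x|]; this determines [W] on
    [(0,oo)]. *)
Definition is_W (W : R -> R) : Prop :=
  (forall x : R, 0 < x -> 0 < W x) /\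
  exists u : R -> R -> R,
    the_csf_from Rabs u /\
    forall p : R * R,
      (0 < fst p /\ snd p = W (fst p)) <->
      (exists a : R, p = rotate_clockwise (PI / 4) (a, u a 1)).

Definition sigma_W (W : R -> R) (x : R) : R :=
  RInt_gen W (at_point x) (Rbar_locally p_infty).

Definition calA0 (W : R -> R) (x : R) : R := 1 / 2 * x * W x + sigma_W W x.

Definition calA1 (W : R -> R) (x : R) : R := PI / 2 - calA0 W x.

(* Main.v *)
(** Let [w(x,t) = sqrt t * W (x / sqrt t)], a self-similar solution with
    [w(.,t)] an involution.  The estimate says that [v(x,t) = w(y(x,t),t)] is
    1-Lipschitz in [x].  Indeed [v] satisfies
    [v_t = al v_xx + be (1 - v_x^2)] with [0 < al <= 1] and [be >= 0], the
    extra term vanishing at slope one because translations of [w] are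
    solutions; so a positive maximum of [v(x2,t) - v(x1,t) - (x2 - x1)] cannot
    appear, and [v -> 0] as [t -> 0].  Replacing [y] by [y + delta] makes [v]
    and [be] bounded, and no condition on [y] at infinity or at [t = 0] is needed.

    The facts about [W] come from the profile [phi = u(.,1)]: uniqueness of the
    flow makes [u] even and self-similar, so
    [phi'' = (1 + phi'^2) (phi - x phi') / 2], and the intercept
    [phi - x phi'] of the tangent line solves a linear equation that
    gives its sign and decay.  In the rotated frame [calA0] is the
    tangent angle: [tan (calA0 W x) = - W' x]. *)

Require Import Defs.
From Stdlib Require Import Reals Lra List ClassicalEpsilon Ranalysis5.
From Coquelicot Require Import Coquelicot.
Open Scope R_scope.

(** * Compactness: upper semicontinuous functions on a box attain their maximum *)

Lemma list_argmax (A : Type) (F : A -> R) (l : list A) (a : A) :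
  In a l -> exists t, In t l /\ forall s, In s l -> F s <= F t.
Proof.
  revert a; induction l as [|b l IH]; intros a Ha; [easy|].
  destruct l as [|c l].
  - exists b; split; [now left|]. intros s [<-|[]]; lra.
  - destruct (IH c (or_introl eq_refl)) as [t [Ht Hm]].
    destruct (Rle_dec (F b) (F t)) as [h|h].
    + exists t; split; [now right|]. intros s [<-|Hs]; auto.
    + exists b; split; [now left|]. intros s [<-|Hs]; [lra|].
      specialize (Hm s Hs); lra.
Qed.

(* If no maximum exists, each point has a neighbourhood on which [f] stays below
   a single larger value of [f]; the largest of the finitely many such values
   coming from a finite subcover contradicts the covering. *)
Lemma usc_attains_max (f : R -> R -> R -> R) (a1 b1 a2 b2 a3 b3 : R)
  (box := fun x y z => a1 <= x <= b1 /\ a2 <= y <= b2 /\ a3 <= z <= b3) :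
  a1 <= b1 -> a2 <= b2 -> a3 <= b3 ->
  (forall x y z, box x y z -> forall eps, 0 < eps -> exists d, 0 < d /\
     forall x' y' z', box x' y' z' -> Rabs (x' - x) < d -> Rabs (y' - y) < d ->
       Rabs (z' - z) < d -> f x' y' z' < f x y z + eps) ->
  exists x y z, box x y z /\ forall x' y' z', box x' y' z' -> f x' y' z' <= f x y z.
Proof.
  intros h1 h2 h3 Husc.
  apply NNPP; intros Hno.
  set (inb := fun p : Compactness.Tn 3 R => let '(x, (y, (z, _))) := p in box x y z).
  set (g := fun p : Compactness.Tn 3 R => let '(x, (y, (z, _))) := p in f x y z).
  assert (Hq : forall p, exists q : Compactness.Tn 3 R * posreal, inb p -> inb (fst q) /\
    forall p', inb p' -> close_n 3 (snd q) p' p -> g p' < g (fst q)).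
  { intros [x [y [z u]]].
    destruct (classic (box x y z)) as [hb|hb].
    (* Outside the box the value is a dummy; only centres inside it are used below. *)
    2: { exists ((x, (y, (z, u))), mkposreal 1 Rlt_0_1). intros h; now elim hb. }
    destruct (classic (exists x' y' z', box x' y' z' /\ f x y z < f x' y' z'))
      as [(x' & y' & z' & hb' & hlt)|hn].
    - destruct (Husc x y z hb (f x' y' z' - f x y z)) as [d [dpos Hd]]; [lra|].
      exists ((x', (y', (z', tt))), mkposreal d dpos). intros _. split; [exact hb'|].
      intros [x2 [y2 [z2 []]]] hb2. simpl. intros (c1 & c2 & c3 & _).
      specialize (Hd x2 y2 z2 hb2 c1 c2 c3). lra.
    - elim Hno. exists x, y, z. split; [exact hb|]. intros x' y' z' hb'.
      apply Rnot_lt_le. intros hlt. apply hn. now exists x', y', z'. }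
  set (Q := fun p => proj1_sig (constructive_indefinite_description _ (Hq p))).
  assert (HQ : forall p, inb p -> inb (fst (Q p)) /\
    forall p', inb p' -> close_n 3 (snd (Q p)) p' p -> g p' < g (fst (Q p))).
  { intros p. unfold Q. exact (proj2_sig (constructive_indefinite_description _ (Hq p))). }
  assert (Hbd : forall p : Compactness.Tn 3 R,
    bounded_n 3 (a1, (a2, (a3, tt))) (b1, (b2, (b3, tt))) p <-> inb p).
  { intros [x [y [z u]]]. simpl. unfold box. tauto. }
  (* The finite subcover comes under a double negation, which suffices because the goal is
     [False]. *)
  apply (compactness_list 3 (a1, (a2, (a3, tt))) (b1, (b2, (b3, tt))) (fun p => snd (Q p))).
  intros [l Hl].
  assert (Hl' : forall x, inb x -> exists t, In t l /\ inb t /\ g x < g (fst (Q t))).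
  { intros x hx. destruct (Hl x) as (t & ht & hb & hc); [now apply Hbd|].
    exists t. split; [exact ht|]. apply Hbd in hb. split; [exact hb|].
    now apply (HQ t hb). }
  set (l' := filter (fun p => if excluded_middle_informative (inb p) then true else false) l).
  assert (Hin : forall t, In t l' <-> In t l /\ inb t).
  { intros t. unfold l'. rewrite filter_In.
    destruct (excluded_middle_informative (inb t)); intuition discriminate. }
  destruct (Hl' (a1, (a2, (a3, tt)))) as (t & ht & hb & _).
  { simpl. unfold box. lra. }
  destruct (list_argmax _ (fun t => g (fst (Q t))) l' t) as (m & hm & Hm).
  { now apply Hin. }
  apply Hin in hm. destruct hm as [hm hmb].
  destruct (Hl' (fst (Q m))) as (s & hs & hsb & hlt).
  { now apply HQ. }
  specialize (Hm s (proj2 (Hin s) (conj hs hsb))). now apply (Rlt_not_le _ _ hlt).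
Qed.

(** * Derivative tests and the two-point maximum principle *)

Ltac rewrite_derive :=
  repeat match goal with
  | |- context [Derive ?f ?x] => erewrite (is_derive_unique f x) by eassumption
  end.

Lemma is_derive_pos_incr (f : R -> R) (x l : R) :
  is_derive f x l -> 0 < l ->
  exists d, 0 < d /\ (forall y, x < y < x + d -> f x < f y) /\
                     (forall y, x - d < y < x -> f y < f x).
Proof.
  intros H Hl. apply is_derive_Reals in H.
  destruct (H (l / 2)) as [d Hd]; [lra|].
  assert (Hq : forall h, h <> 0 -> Rabs h < d -> 0 < (f (x + h) - f x) / h).
  { intros h h0 hd. specialize (Hd h h0 hd). apply Rabs_def2 in Hd. destruct Hd. lra. }
  exists d. split; [apply cond_pos|]. split; intros y hy.
  - specialize (Hq (y - x)). replace (x + (y - x)) with y in Hq by ring.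
    assert (0 < (f y - f x) / (y - x)) as h by (apply Hq; [lra|rewrite Rabs_right; lra]).
    apply (Rmult_lt_compat_r (y - x)) in h; [|lra].
    replace ((f y - f x) / (y - x) * (y - x)) with (f y - f x) in h by (field; lra). lra.
  - specialize (Hq (y - x)). replace (x + (y - x)) with y in Hq by ring.
    assert (0 < (f y - f x) / (y - x)) as h by (apply Hq; [lra|rewrite Rabs_left; lra]).
    apply (Rmult_lt_compat_r (x - y)) in h; [|lra].
    replace ((f y - f x) / (y - x) * (x - y)) with (f x - f y) in h by (field; lra). lra.
Qed.

(** Only earlier points are compared, because a maximum over a time interval may sit at its final
    time. *)
Lemma derive_ge0_left_max (f : R -> R) (x l d : R) :
  0 < d -> is_derive f x l -> (forall y, x - d < y <= x -> f y <= f x) -> 0 <= l.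
Proof.
  intros dpos Hf Hm. apply Rnot_lt_le. intros hl.
  destruct (is_derive_pos_incr (fun y => - f y) x (- l)) as (e & he & _ & h).
  { now apply (is_derive_opp f). } { lra. }
  set (y := x - Rmin d e / 2).
  assert (0 < Rmin d e) by (apply Rmin_glb_lt; lra).
  pose proof (Rmin_l d e). pose proof (Rmin_r d e).
  specialize (h y). specialize (Hm y). unfold y in *. lra.
Qed.

Lemma derive_eq0_max (f : R -> R) (x l d : R) :
  0 < d -> is_derive f x l -> (forall y, Rabs (y - x) < d -> f y <= f x) -> l = 0.
Proof.
  intros dpos Hf Hm. apply Rle_antisym.
  - apply Rnot_lt_le. intros hl.
    destruct (is_derive_pos_incr f x l Hf hl) as (e & he & h & _).
    set (y := x + Rmin d e / 2).
    assert (0 < Rmin d e) by (apply Rmin_glb_lt; lra).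
    pose proof (Rmin_l d e). pose proof (Rmin_r d e).
    specialize (h y). specialize (Hm y). unfold y in *.
    rewrite Rabs_right in Hm; lra.
  - apply (derive_ge0_left_max f x l d); auto.
    intros y hy. apply Hm. apply Rabs_def1; lra.
Qed.

(** Since [f' x = 0], a positive [l] would make [f'] positive just to the right of [x], and the mean
    value theorem would push [f] above its maximum. *)
Lemma derive2_le0_max (f f' : R -> R) (x l d : R) :
  0 < d -> (forall y, is_derive f y (f' y)) -> is_derive f' x l ->
  (forall y, Rabs (y - x) < d -> f y <= f x) -> l <= 0.
Proof.
  intros dpos Hf Hf' Hm. apply Rnot_lt_le. intros hl.
  pose proof (derive_eq0_max f x (f' x) d dpos (Hf x) Hm) as h0.
  destruct (is_derive_pos_incr f' x l Hf' hl) as (e & he & h & _).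
  set (y := x + Rmin d e / 2).
  assert (0 < Rmin d e) by (apply Rmin_glb_lt; lra).
  pose proof (Rmin_l d e). pose proof (Rmin_r d e).
  destruct (MVT_cor2 f f' x y) as (c & hc & hc'); [unfold y; lra| |].
  { intros c _. apply is_derive_Reals, Hf. }
  assert (0 < f' c) by (rewrite <- h0; apply h; unfold y in *; lra).
  assert (0 < f' c * (y - x)) by (apply Rmult_lt_0_compat; unfold y in *; lra).
  specialize (Hm y). unfold y in *. rewrite Rabs_right in Hm; lra.
Qed.

(* The penalty [eta * ln (1 + x1^2)], which has bounded derivatives, confines the
   maximum to a compact set; at a first-order critical point it
   perturbs the equation by [O(eta)], which [K * eta * (t - t1)] absorbs. *)
Lemma two_point_max_principle (v vx vxx vt al be : R -> R -> R) (t1 t0 B C e : R) :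
  0 <= e ->
  (forall x t, t1 <= t <= t0 -> continuity_2d_pt v x t) ->
  (forall x t, t1 <= t <= t0 -> is_derive (fun z => v z t) x (vx x t)) ->
  (forall x t, t1 <= t <= t0 -> is_derive (fun z => vx z t) x (vxx x t)) ->
  (forall x t, t1 <= t <= t0 -> is_derive (fun s => v x s) t (vt x t)) ->
  (forall x t, t1 <= t <= t0 ->
     vt x t = al x t * vxx x t + be x t * (1 - vx x t ^ 2)) ->
  (forall x t, t1 <= t <= t0 -> 0 <= al x t <= 1) ->
  (forall x t, t1 <= t <= t0 -> 0 <= be x t <= B) ->
  (forall x t, t1 <= t <= t0 -> Rabs (v x t) <= C) ->
  (forall x1 x2, x1 <= x2 -> v x2 t1 - v x1 t1 <= x2 - x1 + e) ->
  forall x1 x2 t, x1 <= x2 -> t1 <= t <= t0 -> v x2 t - v x1 t <= x2 - x1 + e.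
Proof.
  intros he Hc Hx Hxx Ht Heq Hal Hbe HC Hi p1 p2 s hp hs.
  set (h := fun x => ln (1 + x ^ 2)).
  set (h' := fun x => 2 * x / (1 + x ^ 2)).
  set (h'' := fun x => 2 * (1 - x ^ 2) / (1 + x ^ 2) ^ 2).
  assert (h1 : forall x, 0 < 1 + x ^ 2) by (intros x; nra).
  assert (dh : forall x, is_derive h x (h' x)).
  { intros x. unfold h, h'. specialize (h1 x). auto_derive; [lra|field; lra]. }
  assert (dh' : forall x, is_derive h' x (h'' x)).
  { intros x. unfold h', h''. specialize (h1 x). auto_derive; [lra|field; lra]. }
  assert (h_bd : forall x, 0 <= h x).
  { intros x. unfold h. rewrite <- ln_1. apply ln_le; nra. }
  assert (h_bd' : forall x, Rabs (h' x) <= 1).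
  { intros x. unfold h'. specialize (h1 x). apply Rabs_le. split.
    - apply Rle_div_r; [lra|]. pose proof (pow2_ge_0 (x + 1)). lra.
    - apply Rle_div_l; [lra|]. pose proof (pow2_ge_0 (x - 1)). lra. }
  assert (h_bd'' : forall x, h'' x <= 2).
  { intros x. unfold h''. specialize (h1 x). apply Rle_div_l; [now apply pow_lt|].
    pose proof (pow2_ge_0 x). nra. }
  assert (B0 : 0 <= B).
  { specialize (Hbe p1 s hs). lra. }
  assert (C0 : 0 <= C).
  { specialize (HC p1 s hs). pose proof (Rabs_pos (v p1 s)). lra. }
  (* At the critical point the errors are [2 * eta] from the second derivative and [3 * B * eta]
     from the [be] term; [K] exceeds their sum by one [eta]. *)
  set (K := 3 + 3 * B).
  assert (key : forall eta, 0 < eta < 1 ->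
    v p2 s - v p1 s - (p2 - p1) - eta * h p1 - K * eta * (s - t1) <= e).
  (* Letting [eta] tend to zero in [key] would give the claim. Concretely, an excess [D] over the
     claim is contradicted by [eta = D / (D + M)], for which [eta * (M - 1) < D]. *)
  2: { apply Rnot_lt_le. intros hlt.
    set (D := v p2 s - v p1 s - (p2 - p1) - e).
    set (M := h p1 + K * (s - t1) + 1).
    assert (M1 : 1 <= M).
    { unfold M. specialize (h_bd p1). assert (0 <= K * (s - t1)); [|lra].
      apply Rmult_le_pos; unfold K; lra. }
    assert (D0 : 0 < D) by (unfold D; lra).
    assert (0 < D / (D + M) < 1).
    { split; [apply Rdiv_lt_0_compat; lra|apply Rlt_div_l; lra]. }
    specialize (key (D / (D + M)) H).
    assert (D <= D / (D + M) * (M - 1)) by (unfold D at 1, M at 2; lra).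
    assert (D / (D + M) * (D + M) = D) by (field; lra).
    nra. }
  intros eta heta. apply Rnot_lt_le. intros hlt.
  set (Phi := fun x1 x2 t => v x2 t - v x1 t - (x2 - x1) - eta * h x1 - K * eta * (t - t1)).
  change (e < Phi p1 p2 s) in hlt.
  assert (K0 : 0 < K) by (unfold K; lra).
  assert (Kt : forall t, t1 <= t <= t0 -> 0 <= K * eta * (t - t1)).
  { intros t ht. apply Rmult_le_pos; [apply Rmult_le_pos|]; lra. }
  (* [L] exceeds the oscillation of [v]. So [Phi] is negative once the gap reaches [L], or once the
     penalty does, which happens for [Rabs x1 >= Rad] because [1 + x ^ 2 >= Rabs x]. *)
  set (L := 2 * C + 1).
  set (Rad := exp (L / eta)).
  assert (hRad : forall x, Rad <= Rabs x -> L <= eta * h x).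
  { intros x hx. rewrite Rmult_comm. apply Rle_div_l; [lra|]. unfold h.
    rewrite <- (ln_exp (L / eta)). fold Rad.
    apply ln_le; [apply exp_pos|]. rewrite <- (pow2_abs x).
    pose proof (Rabs_pos x). nra. }
  assert (Hv : forall x1 x2 t, t1 <= t <= t0 -> v x2 t - v x1 t <= 2 * C).
  { intros x1 x2 t ht. pose proof (HC x1 t ht) as c1. pose proof (HC x2 t ht) as c2.
    apply Rabs_le_between in c1. apply Rabs_le_between in c2. lra. }
  assert (out1 : forall x1 x2 t, x1 <= x2 -> t1 <= t <= t0 -> Rad <= Rabs x1 -> Phi x1 x2 t < 0).
  { intros x1 x2 t hx ht hr. unfold Phi. specialize (Hv x1 x2 t ht).
    specialize (hRad x1 hr). specialize (Kt t ht). unfold L in *. lra. }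
  assert (out2 : forall x1 x2 t, L <= x2 - x1 -> t1 <= t <= t0 -> Phi x1 x2 t < 0).
  { intros x1 x2 t hx ht. unfold Phi. specialize (Hv x1 x2 t ht).
    assert (0 <= eta * h x1) by (apply Rmult_le_pos; [lra|apply h_bd]).
    specialize (Kt t ht). unfold L in *. lra. }
  assert (Rad0 : 0 < Rad) by apply exp_pos.
  (* The gap [r = x2 - x1] replaces [x2], which turns the constraint [x1 <= x2] into the side of a
     box. *)
  destruct (usc_attains_max (fun x1 r t => Phi x1 (x1 + r) t) (- Rad) Rad 0 L t1 t0)
    as (x1 & r & t & (hx1 & hr & ht) & Hmax); try (unfold L; lra).
  { intros x1 r t (hx1 & hr & ht) eps heps.
    destruct (Hc (x1 + r) t ht (mkposreal (eps / 3) ltac:(lra))) as [d1 Hd1].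
    destruct (Hc x1 t ht (mkposreal (eps / 3) ltac:(lra))) as [d2 Hd2].
    assert (Hp : exists d, 0 < d /\ forall x', Rabs (x' - x1) < d -> forall r' t',
       Rabs (r' - r) < d -> Rabs (t' - t) < d ->
       - r' - eta * h x' - K * eta * (t' - t1) < - r - eta * h x1 - K * eta * (t - t1) + eps / 3).
    { assert (ch : continuity_pt h x1).
      { apply derivable_continuous_pt. exists (h' x1). apply is_derive_Reals, dh. }
      destruct (ch (eps / 9)) as (d & hd & Hd); [lra|].
      exists (Rmin d (Rmin (eps / 9) (eps / 9 / K))).
      assert (0 < eps / 9 / K) by (apply Rdiv_lt_0_compat; lra).
      split. { repeat apply Rmin_glb_lt; lra. }
      intros x' hx' r' t' hr' ht'.
      pose proof (Rmin_l d (Rmin (eps / 9) (eps / 9 / K))).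
      pose proof (Rmin_r d (Rmin (eps / 9) (eps / 9 / K))).
      pose proof (Rmin_l (eps / 9) (eps / 9 / K)).
      pose proof (Rmin_r (eps / 9) (eps / 9 / K)).
      assert (a1 : Rabs (h x' - h x1) < eps / 9).
      { destruct (Req_dec x1 x') as [<-|hne].
        - rewrite Rminus_diag, Rabs_R0. lra.
        - apply Hd. split; [split; [exact I|exact hne]|]. simpl. unfold Rdist. lra. }
      assert (a2 : Rabs (r' - r) < eps / 9) by lra.
      assert (a3 : Rabs (t' - t) < eps / 9 / K) by lra.
      apply Rabs_def2 in a1. apply Rabs_def2 in a2. apply Rabs_def2 in a3.
      destruct a1, a2, a3.
      assert (K * (eps / 9 / K) = eps / 9) by (field; lra).
      assert (K * (t - t') < eps / 9) by nra.
      assert (eta * (K * (t - t')) < eps / 9) by nra.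
      assert (eta * (h x1 - h x') < eps / 9) by nra.
      lra. }
    destruct Hp as (d3 & hd3 & Hd3).
    exists (Rmin (d1 / 2) (Rmin d2 d3)).
    split. { destruct d1, d2. simpl. repeat apply Rmin_glb_lt; lra. }
    intros x' r' t' _ hx' hr' ht'.
    pose proof (Rmin_l (d1 / 2) (Rmin d2 d3)). pose proof (Rmin_r (d1 / 2) (Rmin d2 d3)).
    pose proof (Rmin_l d2 d3). pose proof (Rmin_r d2 d3).
    pose proof (cond_pos d1).
    assert (e1 : Rabs (v (x' + r') t' - v (x1 + r) t) < eps / 3).
    { apply Hd1; [|lra]. replace (x' + r' - (x1 + r)) with ((x' - x1) + (r' - r)) by ring.
      eapply Rle_lt_trans; [apply Rabs_triang|]. lra. }
    assert (e2 : Rabs (v x' t' - v x1 t) < eps / 3) by (apply Hd2; lra).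
    assert (e3 := Hd3 x' ltac:(lra) r' t' ltac:(lra) ltac:(lra)).
    apply Rabs_def2 in e1. apply Rabs_def2 in e2. destruct e1, e2.
    unfold Phi. lra. }
  set (x2 := x1 + r) in *.
  (* Outside the box [Phi] is negative, so the maximum over the box, being larger than [e >= 0], is
     global. *)
  assert (Hmax' : forall y1 y2 t', y1 <= y2 -> t1 <= t' <= t0 ->
            Phi y1 y2 t' <= Phi x1 x2 t \/ Phi y1 y2 t' < 0).
  { intros y1 y2 t' hy ht'.
    destruct (Rle_dec Rad (Rabs y1)) as [h2|h2]; [right; now apply out1|].
    destruct (Rle_dec L (y2 - y1)) as [h3|h3]; [right; now apply out2|].
    left. assert (Rabs y1 < Rad) as h4 by lra. apply Rabs_def2 in h4.
    specialize (Hmax y1 (y2 - y1) t').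
    replace (y1 + (y2 - y1)) with y2 in Hmax by ring. apply Hmax. lra. }
  assert (hM : e < Phi x1 x2 t).
  { destruct (Hmax' p1 p2 s hp hs); lra. }
  assert (Hglob : forall y1 y2 t', y1 <= y2 -> t1 <= t' <= t0 -> Phi y1 y2 t' <= Phi x1 x2 t).
  { intros y1 y2 t' hy ht'. destruct (Hmax' y1 y2 t' hy ht'); lra. }
  (* On the diagonal [Phi <= 0], and at the initial time [Phi <= e]; the maximum lies off both. *)
  assert (hr0 : 0 < r).
  { destruct (Rle_lt_or_eq_dec 0 r ltac:(lra)) as [h2|h2]; [exact h2|exfalso].
    assert (x2 = x1) by (unfold x2; lra).
    unfold Phi in hM. rewrite H in hM. specialize (Kt t ht).
    assert (0 <= eta * h x1) by (apply Rmult_le_pos; [lra|apply h_bd]). lra. }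
  assert (ht1 : t1 < t).
  { destruct (Rle_lt_or_eq_dec t1 t ltac:(lra)) as [h2|h2]; [exact h2|exfalso].
    unfold Phi in hM. specialize (Hi x1 x2 ltac:(unfold x2; lra)). rewrite h2 in Hi.
    specialize (Kt t ht).
    assert (0 <= eta * h x1) by (apply Rmult_le_pos; [lra|apply h_bd]). lra. }
  (* Each point can move by less than [r] without breaking [x1 <= x2], so the first and second order
     conditions hold in each space variable separately. *)
  assert (q2 : vx x2 t = 1).
  { assert (vx x2 t - 1 = 0); [|lra].
    apply (derive_eq0_max (fun y => Phi x1 y t) x2 _ r hr0).
    - unfold Phi. pose proof (Hx x2 t ht). auto_derive; [|].
      + eexists; eassumption.
      + rewrite_derive; ring.
    - intros y hy. apply Rabs_def2 in hy. apply Hglob; unfold x2 in *; lra. }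
  assert (q1 : vx x1 t = 1 - eta * h' x1).
  { assert (- vx x1 t + 1 - eta * h' x1 = 0); [|lra].
    apply (derive_eq0_max (fun y => Phi y x2 t) x1 _ r hr0).
    - unfold Phi. pose proof (Hx x1 t ht). pose proof (dh x1). auto_derive; [|].
      + repeat split; eexists; eassumption.
      + rewrite_derive; ring.
    - intros y hy. apply Rabs_def2 in hy. apply Hglob; unfold x2 in *; lra. }
  assert (s2 : vxx x2 t <= 0).
  { apply (derive2_le0_max (fun y => Phi x1 y t) (fun y => vx y t - 1) x2 _ r hr0).
    - intros y. unfold Phi. pose proof (Hx y t ht). auto_derive; [|].
      + eexists; eassumption.
      + rewrite_derive; ring.
    - pose proof (Hxx x2 t ht). auto_derive; [eexists; eassumption|].
      rewrite_derive; ring.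
    - intros y hy. apply Rabs_def2 in hy. apply Hglob; unfold x2 in *; lra. }
  assert (s1 : - vxx x1 t - eta * h'' x1 <= 0).
  { apply (derive2_le0_max (fun y => Phi y x2 t) (fun y => - vx y t + 1 - eta * h' y) x1 _ r hr0).
    - intros y. unfold Phi. pose proof (Hx y t ht). pose proof (dh y). auto_derive; [|].
      + repeat split; eexists; eassumption.
      + rewrite_derive; ring.
    - pose proof (Hxx x1 t ht). pose proof (dh' x1).
      auto_derive; [repeat split; eexists; eassumption|].
      rewrite_derive; ring.
    - intros y hy. apply Rabs_def2 in hy. apply Hglob; unfold x2 in *; lra. }
  assert (st : 0 <= vt x2 t - vt x1 t - K * eta).
  { apply (derive_ge0_left_max (fun u => Phi x1 x2 u) t _ (t - t1) ltac:(lra)).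
    - unfold Phi. pose proof (Ht x1 t ht). pose proof (Ht x2 t ht). auto_derive; [|].
      + repeat split; eexists; eassumption.
      + rewrite_derive; ring.
    - intros u hu. apply Hglob; unfold x2; lra. }
  (* The slope at [x2] is exactly one, so its [be] term vanishes; at [x1] the slope is off by
     [eta * h' x1] and that term is of order [eta]. *)
  rewrite (Heq x1 t ht), (Heq x2 t ht), q1, q2 in st.
  pose proof (Hal x1 t ht). pose proof (Hal x2 t ht).
  pose proof (Hbe x1 t ht).
  pose proof (h_bd' x1) as k1. apply Rabs_le_between in k1.
  pose proof (h_bd'' x1) as k2.
  assert (al x2 t * vxx x2 t <= 0) by nra.
  assert (- (2 * eta) <= vxx x1 t) by nra.
  assert (- (2 * eta) <= al x1 t * vxx x1 t).
  { apply Rle_trans with (al x1 t * (- (2 * eta))); [nra|]. apply Rmult_le_compat_l; lra. }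
  assert (- (3 * eta) <= 1 - (1 - eta * h' x1) ^ 2).
  { assert (- eta <= eta * h' x1 <= eta) by nra. nra. }
  assert (- (3 * B * eta) <= be x1 t * (1 - (1 - eta * h' x1) ^ 2)).
  { apply Rle_trans with (be x1 t * (- (3 * eta))); [nra|]. apply Rmult_le_compat_l; lra. }
  unfold K in st. nra.
Qed.

Lemma derive_le0_nonincr (f f' : R -> R) (a b : R) :
  a <= b -> (forall x, a <= x <= b -> is_derive f x (f' x)) ->
  (forall x, a <= x <= b -> f' x <= 0) -> f b <= f a.
Proof.
  intros hab Hf Hn. destruct (Rle_lt_or_eq_dec a b hab) as [h|<-]; [|lra].
  destruct (MVT_cor2 f f' a b h) as (c & hc & hc').
  { intros c hc. now apply is_derive_Reals, Hf. }
  assert (0 <= (- f' c) * (b - a)); [|lra].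
  apply Rmult_le_pos; [|lra]. specialize (Hn c). lra.
Qed.

Lemma derive_le1_of_slope (f : R -> R) (x l : R) :
  is_derive f x l -> (forall y, x <= y -> f y - f x <= y - x) -> l <= 1.
Proof.
  intros Hf Hs. apply Rnot_lt_le. intros hl.
  destruct (is_derive_pos_incr (fun y => f y - y) x (l - 1)) as (d & hd & h & _).
  { auto_derive; [eexists; eassumption|]. rewrite_derive. ring. } { lra. }
  specialize (h (x + d / 2)). specialize (Hs (x + d / 2)). lra.
Qed.

(** * Gradient bound for positive solutions, from the equation and signs of [W] *)

Section SlopeBound.
Variables W W1 W2 : R -> R.
Hypothesis W_pos : forall x, 0 < x -> 0 < W x.
Hypothesis W_derive : forall x, 0 < x -> is_derive W x (W1 x).
Hypothesis W1_derive : forall x, 0 < x -> is_derive W1 x (W2 x).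
Hypothesis W1_neg : forall x, 0 < x -> W1 x < 0.
Hypothesis W_ode : forall x, 0 < x -> W2 x = 1 / 2 * (1 + W1 x ^ 2) * (W x - x * W1 x).

(* [G (x / sqrt t) / (2 * sqrt t)] is the time derivative of
   [sqrt t * W (x / sqrt t)]. *)
Let G (x : R) : R := W x - x * W1 x.

Lemma W_intercept_pos (x : R) : 0 < x -> 0 < G x.
Proof.
  intros hx. unfold G. specialize (W_pos x hx). specialize (W1_neg x hx).
  nra.
Qed.

Lemma W_nonincr (a b : R) : 0 < a -> a <= b -> W b <= W a.
Proof.
  intros ha hab. apply (derive_le0_nonincr W W1 a b hab).
  - intros x hx. apply W_derive. lra.
  - intros x hx. apply Rlt_le, W1_neg. lra.
Qed.

(** [G' = - x * W2], and the equation gives [W2] the sign of [G]. This bounds the coefficient [be]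
    as long as the solution stays away from zero. *)
Lemma W_intercept_nonincr (a b : R) : 0 < a -> a <= b -> G b <= G a.
Proof.
  intros ha hab. apply (derive_le0_nonincr G (fun x => - x * W2 x) a b hab).
  - intros x hx. pose proof (W_derive x ltac:(lra)). pose proof (W1_derive x ltac:(lra)).
    unfold G. auto_derive; [repeat split; eexists; eassumption|]. rewrite_derive. ring.
  - intros x hx. rewrite W_ode by lra. pose proof (W_intercept_pos x ltac:(lra)) as hG. fold (G x).
    assert (0 <= x * (1 / 2 * (1 + W1 x ^ 2) * G x)); [|lra].
    pose proof (pow2_ge_0 (W1 x)).
    repeat apply Rmult_le_pos; lra.
Qed.

(** The left side is [v_x] for [v = sqrt t * W (z / sqrt t)]. The two-point principle, started at
    ever smaller times [t1], shows that [v] grows with slope at most one. *)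
Lemma gradient_bound_bounded_below (T delta : R) (z zx zxx zt : R -> R -> R) :
  0 < delta ->
  (forall x t, 0 < t < T -> continuity_2d_pt z x t) ->
  (forall x t, 0 < t < T -> is_derive (fun u => z u t) x (zx x t)) ->
  (forall x t, 0 < t < T -> is_derive (fun u => zx u t) x (zxx x t)) ->
  (forall x t, 0 < t < T -> is_derive (fun s => z x s) t (zt x t)) ->
  (forall x t, 0 < t < T -> zt x t = zxx x t / (1 + zx x t ^ 2)) ->
  (forall x t, 0 < t < T -> delta <= z x t) ->
  forall x t, 0 < t < T -> W1 (z x t / sqrt t) * zx x t <= 1.
Proof.
  intros hd Hc Hx Hxx Ht Heq Hz x0 t0 ht0.
  set (Y := fun x t => z x t / sqrt t).
  set (v := fun x t => sqrt t * W (Y x t)).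
  set (vx := fun x t => W1 (Y x t) * zx x t).
  set (vxx := fun x t => W1 (Y x t) * zxx x t + W2 (Y x t) * zx x t ^ 2 / sqrt t).
  set (vt := fun x t => G (Y x t) / (2 * sqrt t) + W1 (Y x t) * zt x t).
  set (al := fun x t => / (1 + zx x t ^ 2)).
  set (be := fun x t => G (Y x t) / (2 * sqrt t) * / (1 + zx x t ^ 2)).
  assert (st : forall t, 0 < t -> 0 < sqrt t) by apply sqrt_lt_R0.
  assert (Ypos : forall x t, 0 < t < T -> 0 < Y x t).
  { intros x t ht. apply Rdiv_lt_0_compat; [|apply st; lra]. specialize (Hz x t ht). lra. }
  assert (Dx : forall x t, 0 < t < T -> is_derive (fun u => v u t) x (vx x t)).
  { intros x t ht. unfold v, vx. pose proof (Hx x t ht).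
    pose proof (W_derive _ (Ypos x t ht)). specialize (st t (proj1 ht)).
    unfold Y in *. auto_derive; [repeat split; eexists; eassumption|].
    unfold Rdiv in *. rewrite_derive. field. lra. }
  assert (Dxx : forall x t, 0 < t < T -> is_derive (fun u => vx u t) x (vxx x t)).
  { intros x t ht. unfold vx, vxx. pose proof (Hx x t ht). pose proof (Hxx x t ht).
    pose proof (W1_derive _ (Ypos x t ht)). specialize (st t (proj1 ht)).
    unfold Y in *. auto_derive; [repeat split; eexists; eassumption|].
    unfold Rdiv in *. rewrite_derive. field. lra. }
  assert (Dt : forall x t, 0 < t < T -> is_derive (fun s => v x s) t (vt x t)).
  { intros x t ht. unfold v, vt, G. pose proof (Ht x t ht).
    pose proof (W_derive _ (Ypos x t ht)). specialize (st t (proj1 ht)).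
    unfold Y in *. auto_derive; [repeat split; try lra; eexists; eassumption|].
    unfold Rdiv in *. rewrite_derive. field. lra. }
  assert (Cv : forall x t, 0 < t < T -> continuity_2d_pt v x t).
  { intros x t ht. unfold v, Y.
    assert (c : continuity_2d_pt (fun _ s => sqrt s) x t).
    { apply (continuity_1d_2d_pt_comp sqrt (fun _ s => s)); [|apply continuity_2d_pt_id2].
      apply continuity_pt_sqrt. lra. }
    apply continuity_2d_pt_mult; [exact c|].
    apply (continuity_1d_2d_pt_comp W (fun x t => z x t / sqrt t)).
    - apply derivable_continuous_pt. exists (W1 (Y x t)).
      apply is_derive_Reals, W_derive, Ypos, ht.
    - apply continuity_2d_pt_mult; [now apply Hc|].
      apply continuity_2d_pt_inv; [exact c|]. specialize (st t (proj1 ht)). lra. }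
  assert (one : forall x t, 1 <= 1 + zx x t ^ 2).
  { intros x t. pose proof (pow2_ge_0 (zx x t)). lra. }
  (* Once [W_ode] replaces [W2], the terms in [W1 ^ 2 * zx ^ 2] cancel and the rest is
     [G / (2 * sqrt t)] on both sides. *)
  assert (Ev : forall x t, 0 < t < T ->
    vt x t = al x t * vxx x t + be x t * (1 - vx x t ^ 2)).
  { intros x t ht. unfold vt, al, be, vx, vxx. rewrite Heq, W_ode by auto.
    fold (G (Y x t)). specialize (st t (proj1 ht)). specialize (one x t). field. lra. }
  assert (Hal : forall x t, 0 < al x t <= 1).
  { intros x t. unfold al. specialize (one x t). split; [apply Rinv_0_lt_compat; lra|].
    rewrite <- Rinv_1. apply Rinv_le_contravar; lra. }
  assert (Lip : forall e, 0 < e -> forall x2, x0 <= x2 ->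
    v x2 t0 - v x0 t0 <= x2 - x0 + e).
  { intros e he x2 hx2.
    (* For [t1 <= 1] one has [Y >= delta], so [0 < v <= sqrt t1 * W delta] at time [t1]; the square
       of [e / W delta] makes this at most [e]. *)
    set (t1 := Rmin t0 (Rmin 1 ((e / W delta) ^ 2))).
    pose proof (W_pos delta hd) as Wd.
    assert (0 < e / W delta) by (apply Rdiv_lt_0_compat; lra).
    assert (t1pos : 0 < t1).
    { unfold t1. repeat apply Rmin_glb_lt; try lra. now apply pow_lt. }
    assert (t1a : t1 <= t0) by apply Rmin_l.
    assert (t1b : t1 <= 1).
    { eapply Rle_trans; [apply Rmin_r|apply Rmin_l]. }
    assert (t1c : sqrt t1 <= e / W delta).
    { rewrite <- (sqrt_pow2 (e / W delta)) by lra. apply sqrt_le_1_alt.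
      eapply Rle_trans; [apply Rmin_r|apply Rmin_r]. }
    (* A lower bound for [Y] on the whole time interval, where the monotone [W] and [G] take their
       largest values. *)
    set (Y0 := delta / sqrt t0).
    assert (Y0pos : 0 < Y0) by (apply Rdiv_lt_0_compat; [lra|apply st; lra]).
    assert (YY0 : forall x t, t1 <= t <= t0 -> Y0 <= Y x t).
    { intros x t ht. unfold Y0, Y. apply Rmult_le_compat; try lra.
      - apply Rlt_le, Rinv_0_lt_compat, st; lra.
      - apply Hz; lra.
      - apply Rinv_le_contravar; [apply st; lra|apply sqrt_le_1_alt; lra]. }
    apply (two_point_max_principle v vx vxx vt al be t1 t0
      (G Y0 / (2 * sqrt t1)) (sqrt t0 * W Y0) e); try lra; intros x t.
    - intros ht. apply Cv; lra.
    - intros ht. apply Dx; lra.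
    - intros ht. apply Dxx; lra.
    - intros ht. apply Dt; lra.
    - intros ht. apply Ev; lra.
    - intros ht. specialize (Hal x t). lra.
    - intros ht. specialize (Hal x t). unfold be. fold (al x t).
      assert (gp : 0 < G (Y x t)) by (apply W_intercept_pos, Ypos; lra).
      assert (gb : G (Y x t) <= G Y0) by (apply W_intercept_nonincr; [lra|apply YY0; lra]).
      assert (s0 : 0 < sqrt t1) by (apply st; lra).
      assert (s1 : sqrt t1 <= sqrt t) by (apply sqrt_le_1_alt; lra).
      assert (i1 : 0 < / (2 * sqrt t)) by (apply Rinv_0_lt_compat; lra).
      assert (i2 : / (2 * sqrt t) <= / (2 * sqrt t1)) by (apply Rinv_le_contravar; lra).
      assert (0 < G (Y x t) / (2 * sqrt t)) by (now apply Rmult_lt_0_compat).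
      assert (G (Y x t) / (2 * sqrt t) <= G Y0 / (2 * sqrt t1)).
      { apply Rmult_le_compat; lra. }
      nra.
    - intros ht. unfold v.
      assert (0 < W (Y x t)) by (apply W_pos, Ypos; lra).
      assert (W (Y x t) <= W Y0) by (apply W_nonincr; [lra|apply YY0; lra]).
      assert (0 < sqrt t) by (apply st; lra).
      assert (sqrt t <= sqrt t0) by (apply sqrt_le_1_alt; lra).
      rewrite Rabs_right; [|nra]. apply Rmult_le_compat; lra.
    - intros hxt. unfold v.
      assert (s0 : 0 < sqrt t1) by (apply st; lra).
      assert (s1 : sqrt t1 <= 1) by (rewrite <- sqrt_1; apply sqrt_le_1_alt; lra).
      assert (0 < W (Y x t1)) by (apply W_pos, Ypos; lra).
      assert (W (Y t t1) <= W delta).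
      { apply W_nonincr; [lra|]. unfold Y. apply Rle_div_r; [lra|].
        specialize (Hz t t1 ltac:(lra)). nra. }
      assert (sqrt t1 * W (Y t t1) <= e / W delta * W delta).
      { apply Rmult_le_compat; try lra. apply Rlt_le, W_pos, Ypos; lra. }
      replace (e / W delta * W delta) with e in * by (field; lra).
      assert (0 < sqrt t1 * W (Y x t1)) by (now apply Rmult_lt_0_compat).
      lra. }
  apply (derive_le1_of_slope (fun u => v u t0) x0 (vx x0 t0) (Dx x0 t0 ht0)).
  intros x2 hx2. apply le_epsilon. intros e he. now apply Lip.
Qed.

(** The one-sided bound is applied to [y + d] and to its reflection in [x], which gives both signs
    of [yx]; then [d] tends to zero by continuity of [W1]. *)
Lemma gradient_bound (T : R) (y yx yxx yt : R -> R -> R) :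
  (forall x t, 0 < t < T -> continuity_2d_pt y x t) ->
  (forall x t, 0 < t < T -> is_derive (fun u => y u t) x (yx x t)) ->
  (forall x t, 0 < t < T -> is_derive (fun u => yx u t) x (yxx x t)) ->
  (forall x t, 0 < t < T -> is_derive (fun s => y x s) t (yt x t)) ->
  (forall x t, 0 < t < T -> yt x t = yxx x t / (1 + yx x t ^ 2)) ->
  (forall x t, 0 < t < T -> 0 < y x t) ->
  forall x t, 0 < t < T -> Rabs (yx x t) * - W1 (y x t / sqrt t) <= 1.
Proof.
  intros Hc Hx Hxx Ht Heq Hp x t ht.
  assert (st : 0 < sqrt t) by (apply sqrt_lt_R0; lra).
  assert (Hd : forall d, 0 < d -> Rabs (yx x t) * - W1 ((y x t + d) / sqrt t) <= 1).
  { intros d hd.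
    assert (h1 := gradient_bound_bounded_below T d (fun x t => y x t + d) yx yxx yt hd).
    assert (h2 := gradient_bound_bounded_below T d (fun x t => y (- x) t + d)
      (fun x t => - yx (- x) t) (fun x t => yxx (- x) t) (fun x t => yt (- x) t) hd).
    assert (g1 : W1 ((y x t + d) / sqrt t) * yx x t <= 1).
    { apply h1; auto; intros u s hs.
      - apply continuity_2d_pt_plus; [now apply Hc|apply continuity_2d_pt_const].
      - pose proof (Hx u s hs). auto_derive; [eexists; eassumption|]. rewrite_derive. ring.
      - pose proof (Ht u s hs). auto_derive; [eexists; eassumption|]. rewrite_derive. ring.
      - specialize (Hp u s hs). lra. }
    assert (g2 : W1 ((y (- - x) t + d) / sqrt t) * - yx (- - x) t <= 1).
    { apply h2; auto; intros u s hs.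
      - apply continuity_2d_pt_plus; [|apply continuity_2d_pt_const].
        intros eps. destruct (Hc (- u) s hs eps) as [e he]. exists e.
        intros u' s' hu hs'. apply he; [|exact hs'].
        replace (- u' - - u) with (- (u' - u)) by ring. now rewrite Rabs_Ropp.
      - pose proof (Hx (- u) s hs). auto_derive; [eexists; eassumption|]. rewrite_derive. ring.
      - pose proof (Hxx (- u) s hs). auto_derive; [eexists; eassumption|]. rewrite_derive. ring.
      - pose proof (Ht (- u) s hs). auto_derive; [eexists; eassumption|]. rewrite_derive. ring.
      - rewrite Heq by exact hs. f_equal. ring.
      - specialize (Hp (- u) s hs). lra. }
    rewrite Ropp_involutive in g2. unfold Rabs. destruct (Rcase_abs (yx x t)); lra. }
  set (Y := y x t / sqrt t).
  assert (Ypos : 0 < Y) by (apply Rdiv_lt_0_compat; auto).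
  apply Rnot_lt_le. intros hlt.
  set (q := Rabs (yx x t)) in *.
  assert (q0 : 0 < q).
  { pose proof (Rabs_pos (yx x t)). fold q in H. destruct (Rle_lt_or_eq_dec 0 q H); [easy|].
    rewrite <- e in hlt. lra. }
  assert (cW : continuity_pt W1 Y).
  { apply derivable_continuous_pt. exists (W2 Y). apply is_derive_Reals. auto. }
  (* With this tolerance [q * - W1] stays above one near [Y]. *)
  destruct (cW ((q * - W1 Y - 1) / q)) as (d & hd & Hcont).
  { apply Rdiv_lt_0_compat; lra. }
  specialize (Hcont (Y + d / 2)). simpl in Hcont. unfold Rdist in Hcont.
  assert (c : Rabs (W1 (Y + d / 2) - W1 Y) < (q * - W1 Y - 1) / q).
  { apply Hcont. split; [split; [exact I|lra]|]. rewrite Rabs_right; lra. }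
  apply Rabs_def2 in c. destruct c as [c _].
  (* Raising [y] by [sqrt t * (d / 2)] moves the argument of [W1] by exactly [d / 2]. *)
  specialize (Hd (sqrt t * (d / 2))).
  replace ((y x t + sqrt t * (d / 2)) / sqrt t) with (Y + d / 2) in Hd by (unfold Y; field; lra).
  assert (q * - W1 (Y + d / 2) <= 1) by (apply Hd; nra).
  assert (q * ((q * - W1 Y - 1) / q) = q * - W1 Y - 1) by (field; lra).
  nra.
Qed.
End SlopeBound.

(** * Positivity, asymptotics and slope of the even profile [phi] *)

Lemma is_lim_scal_inv (k : R) : is_lim (fun x => k * / x) p_infty 0.
Proof.
  evar_last.
  - apply (is_lim_scal_l Rinv k p_infty 0).
    apply (is_lim_inv (fun x => x) p_infty p_infty); [apply is_lim_id|easy].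
  - simpl. f_equal. ring.
Qed.

Section SelfSimilar.
Variables phi phi1 phi2 : R -> R.
Hypothesis phi_derive : forall x, is_derive phi x (phi1 x).
Hypothesis phi1_derive : forall x, is_derive phi1 x (phi2 x).
Hypothesis phi_ode : forall x, phi2 x = 1 / 2 * (1 + phi1 x ^ 2) * (phi x - x * phi1 x).
Hypothesis phi_even : forall x, phi (- x) = phi x.
Hypothesis phi_asymp :
  forall eps, 0 < eps -> exists M, 0 < M /\ forall x, M <= x -> Rabs (phi x - x) <= eps * x.

Let g (x : R) : R := phi x - x * phi1 x.

Lemma phi_intercept_derive (x : R) : is_derive g x (- (x / 2 * (1 + phi1 x ^ 2)) * g x).
Proof.
  pose proof (phi_derive x). pose proof (phi1_derive x). unfold g.
  auto_derive; [repeat split; eexists; eassumption|]. rewrite_derive.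
  rewrite phi_ode. field.
Qed.

(** The linear equation for [g] has the integrating factor [exp (P x)], so [g * exp P] is constant
    and [g] never changes sign. *)
Lemma phi_intercept_sign (x : R) : exists k, 0 < k /\ g x = k * g 0.
Proof.
  set (c := fun x => x / 2 * (1 + phi1 x ^ 2)).
  assert (Hc : forall x, continuous c x).
  { intros z. apply (ex_derive_continuous c). pose proof (phi1_derive z). unfold c.
    auto_derive. repeat split; eexists; eassumption. }
  set (P := fun x => RInt c 0 x).
  assert (HP : forall x, is_derive P x (c x)).
  { intros z. apply (is_derive_RInt c P 0 z); [|apply Hc].
    apply filter_forall. intros b. apply (RInt_correct c 0 b).
    apply ex_RInt_continuous. intros w _. apply Hc. }
  set (h := fun x => g x * exp (P x)).
  assert (Hh : forall x, is_derive h x 0).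
  { intros z. pose proof (HP z). pose proof (phi_intercept_derive z). unfold h.
    auto_derive; [repeat split; eexists; eassumption|]. rewrite_derive.
    unfold c. field. }
  assert (hx : h x = h 0).
  { destruct (MVT_gen h 0 x (fun _ => 0)) as (z & _ & hz).
    - intros z _. apply Hh.
    - intros z _. apply derivable_continuous_pt. exists 0. apply is_derive_Reals, Hh.
    - lra. }
  unfold h in hx. exists (exp (P 0) / exp (P x)).
  pose proof (exp_pos (P x)). pose proof (exp_pos (P 0)).
  split; [now apply Rdiv_lt_0_compat|].
  apply (Rmult_eq_reg_r (exp (P x))); [|lra]. rewrite hx. field. lra.
Qed.

Lemma phi1_odd (x : R) : phi1 (- x) = - phi1 x.
Proof.
  assert (h : is_derive phi (- x) (- phi1 x)).
  { apply (is_derive_ext (fun z => phi (- z))); [apply phi_even|].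
    pose proof (phi_derive x) as h. rewrite <- (Ropp_involutive x) in h at 1.
    auto_derive; [eexists; eassumption|]. rewrite_derive. ring. }
  rewrite <- (is_derive_unique _ _ _ h). symmetry. apply is_derive_unique, phi_derive.
Qed.

(** Otherwise [g <= 0], so [phi] is concave; being even it has slope zero at the origin, hence stays
    at most [phi 0 <= 0] on the right, against its linear growth. *)
Lemma phi0_pos : 0 < phi 0.
Proof.
  apply Rnot_le_lt. intros h0.
  assert (g0 : g 0 <= 0) by (unfold g; lra).
  assert (hg : forall x, g x <= 0).
  { intros x. destruct (phi_intercept_sign x) as (k & hk & ->). nra. }
  assert (p0 : phi1 0 = 0).
  { pose proof (phi1_odd 0) as h. rewrite Ropp_0 in h. lra. }
  assert (h1 : forall x, 0 <= x -> phi1 x <= 0).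
  { intros x hx. rewrite <- p0. apply (derive_le0_nonincr phi1 phi2); auto.
    intros z _. rewrite phi_ode. fold (g z). specialize (hg z).
    pose proof (pow2_ge_0 (phi1 z)). nra. }
  assert (h2 : forall x, 0 <= x -> phi x <= phi 0).
  { intros x hx. apply (derive_le0_nonincr phi phi1); auto. intros z hz. apply h1. lra. }
  destruct (phi_asymp (1 / 2)) as (M & hM & h); [lra|].
  specialize (h M ltac:(lra)). specialize (h2 M ltac:(lra)).
  apply Rabs_le_between in h. lra.
Qed.

Lemma phi_intercept_pos (x : R) : 0 < g x.
Proof.
  destruct (phi_intercept_sign x) as (k & hk & ->). pose proof phi0_pos.
  apply Rmult_lt_0_compat; [exact hk|]. unfold g. lra.
Qed.

(** The damping rate of [g] is at least [x / 2], while [1 + x ^ 2 / 4] grows at the smaller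
    logarithmic rate [(x / 2) / (1 + x ^ 2 / 4)]. *)
Lemma phi_intercept_decay (x : R) : 0 <= x -> (1 + x ^ 2 / 4) * g x <= phi 0.
Proof.
  intros hx. replace (phi 0) with ((1 + 0 ^ 2 / 4) * g 0) by (unfold g; field).
  apply (derive_le0_nonincr (fun x => (1 + x ^ 2 / 4) * g x)
    (fun x => - (x / 2) * (phi1 x ^ 2 + x ^ 2 / 4 * (1 + phi1 x ^ 2)) * g x)); auto.
  - intros z _. pose proof (phi_intercept_derive z). auto_derive; [eexists; eassumption|].
    rewrite_derive. field.
  - intros z hz. pose proof (phi_intercept_pos z). pose proof (pow2_ge_0 (phi1 z)). pose proof (pow2_ge_0 z).
    assert (0 <= phi1 z ^ 2 + z ^ 2 / 4 * (1 + phi1 z ^ 2)) by nra.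
    assert (0 <= z / 2 * (phi1 z ^ 2 + z ^ 2 / 4 * (1 + phi1 z ^ 2)) * g z); [|lra].
    repeat apply Rmult_le_pos; lra.
Qed.

(** The quotient [phi x / x] has derivative [- g x / x ^ 2 < 0] and tends to one, so it approaches
    one from above. *)
Lemma phi_ge (x : R) : 0 < x -> x <= phi x.
Proof.
  intros hx. apply Rnot_lt_le. intros hlt.
  destruct (phi_asymp ((x - phi x) / x / 2)) as (M & hM & h).
  { apply Rdiv_lt_0_compat; [|lra]. apply Rdiv_lt_0_compat; lra. }
  set (z := Rmax x M). pose proof (Rmax_l x M). pose proof (Rmax_r x M). fold z in H, H0.
  specialize (h z ltac:(lra)). apply Rabs_le_between in h.
  assert (hm : phi z / z <= phi x / x).
  { apply (derive_le0_nonincr (fun x => phi x / x) (fun x => - g x / x ^ 2)); auto.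
    - intros w hw. pose proof (phi_derive w). auto_derive; [repeat split; [eexists; eassumption|lra]|].
      rewrite_derive. unfold g. field. lra.
    - intros w hw. pose proof (phi_intercept_pos w). assert (0 < g w / w ^ 2); [|rewrite Rdiv_opp_l; lra].
      apply Rdiv_lt_0_compat; [easy|]. apply pow_lt. lra. }
  assert (phi z <= phi x / x * z) by (apply Rle_div_l; lra).
  assert (hd : phi x / x * z = z - (x - phi x) / x * z) by (field; lra).
  assert (0 < (x - phi x) / x * z).
  { apply Rmult_lt_0_compat; [|lra]. apply Rdiv_lt_0_compat; lra. }
  lra.
Qed.

(** The decay [g x <= 4 * phi 0 / x ^ 2] bounds the derivative of [phi x / x] below by
    [- 4 * phi 0 / x ^ 4]; integrating out to infinity yields the factor [4 / 3]. *)
Lemma phi_le (x : R) : 0 < x -> phi x <= x + 4 / 3 * phi 0 / x ^ 2.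
Proof.
  intros hx. set (C := 4 / 3 * phi 0). pose proof phi0_pos as p0.
  apply Rnot_lt_le. intros hlt.
  (* [q] is the excess of [phi x / x - C / x ^ 3] over one. This expression is nondecreasing, but at
     a far point [z] the asymptotics leave room only for [q / 2]. *)
  set (q := (phi x - x - C / x ^ 2) / x).
  assert (hq : 0 < q) by (apply Rdiv_lt_0_compat; lra).
  destruct (phi_asymp (q / 2)) as (M & hM & h); [lra|].
  set (z := Rmax x M). pose proof (Rmax_l x M). pose proof (Rmax_r x M). fold z in H, H0.
  specialize (h z ltac:(lra)). apply Rabs_le_between in h.
  assert (hm : C / z ^ 3 - phi z / z <= C / x ^ 3 - phi x / x).
  { apply (derive_le0_nonincr (fun x => C / x ^ 3 - phi x / x)
      (fun x => (x ^ 2 * g x - 3 * C) / x ^ 4)); auto.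
    - intros w hw. pose proof (phi_derive w).
      auto_derive; [repeat split; try (eexists; eassumption); try lra|].
      + assert (0 < w ^ 3) by (apply pow_lt; lra). simpl in *. lra.
      + rewrite_derive. unfold g. field. lra.
    - intros w hw. assert (0 < w ^ 4) by (apply pow_lt; lra).
      apply Rle_div_l; [easy|]. pose proof (phi_intercept_decay w ltac:(lra)). pose proof (phi_intercept_pos w).
      unfold C. lra. }
  assert (0 < C / z ^ 3).
  { apply Rdiv_lt_0_compat; [unfold C; lra|apply pow_lt; lra]. }
  assert (phi x / x - C / x ^ 3 = 1 + q) by (unfold q; field; lra).
  assert (phi z / z <= 1 + q / 2) by (apply Rle_div_l; lra).
  lra.
Qed.

Lemma phi1_incr (x y : R) : x < y -> phi1 x < phi1 y.
Proof.
  intros hxy. destruct (MVT_cor2 phi1 phi2 x y hxy) as (c & hc & _).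
  { intros c _. apply is_derive_Reals, phi1_derive. }
  assert (0 < phi2 c * (y - x)); [|lra].
  apply Rmult_lt_0_compat; [|lra]. rewrite phi_ode. fold (g c). pose proof (phi_intercept_pos c).
  pose proof (pow2_ge_0 (phi1 c)). nra.
Qed.

Lemma phi1_bounds (x : R) : 1 <= x ->
  1 - phi 0 / x <= phi1 x <= 1 + 4 / 3 * phi 0 / x.
Proof.
  intros hx. pose proof (phi_le x ltac:(lra)) as hle. pose proof (phi_ge x ltac:(lra)) as hge.
  pose proof (phi_intercept_decay x ltac:(lra)) as hd. pose proof (phi_intercept_pos x) as hg.
  pose proof phi0_pos. assert (hx2 : 1 <= x ^ 2) by nra.
  assert (g x <= phi 0) by nra.
  assert (e : phi1 x = (phi x - g x) / x) by (unfold g; field; lra).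
  assert (4 / 3 * phi 0 / x ^ 2 <= 4 / 3 * phi 0) by (apply Rle_div_l; nra).
  rewrite e. split.
  - apply Rle_div_r; [lra|]. replace ((1 - phi 0 / x) * x) with (x - phi 0) by (field; lra). lra.
  - apply Rle_div_l; [lra|].
    replace ((1 + 4 / 3 * phi 0 / x) * x) with (x + 4 / 3 * phi 0) by (field; lra). lra.
Qed.

Lemma phi1_lim : is_lim phi1 p_infty 1.
Proof.
  apply (is_lim_le_le_loc (fun x => 1 - phi 0 * / x) (fun x => 1 + 4 / 3 * phi 0 * / x)).
  - exists 1. intros x hx. apply phi1_bounds. lra.
  - evar_last.
    + apply is_lim_minus'; [apply is_lim_const|apply is_lim_scal_inv].
    + simpl. f_equal. ring.
  - evar_last.
    + apply is_lim_plus'; [apply is_lim_const|apply is_lim_scal_inv].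
    + simpl. f_equal. ring.
Qed.

(** Here [phi x - x] is of order [x ^ (-2)] and [phi x + x] of order [x]. In the rotated frame the
    expression is twice abscissa times ordinate, the boundary term in the integral of [W]. *)
Lemma phi_sqr_lim : is_lim (fun x => phi x ^ 2 - x ^ 2) p_infty 0.
Proof.
  set (C := 4 / 3 * phi 0).
  apply (is_lim_le_le_loc (fun _ => 0) (fun x => (2 * C + C ^ 2) * / x)).
  - exists 1. intros x hx. pose proof (phi_ge x ltac:(lra)). pose proof (phi_le x ltac:(lra)).
    fold C in H0. pose proof phi0_pos.
    assert (0 < / x <= 1).
    { split; [apply Rinv_0_lt_compat; lra|]. rewrite <- Rinv_1. apply Rinv_le_contravar; lra. }
    assert (0 < C) by (unfold C; lra).
    set (i := / x) in *.
    assert (ix : i * x = 1) by (unfold i; field; lra).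
    replace (C / x ^ 2) with (C * i ^ 2) in H0 by (unfold i; field; lra).
    split; [nra|].
    assert (0 <= i ^ 2 <= i) by nra. assert (0 <= i ^ 4 <= i) by nra.
    apply Rle_trans with ((x + C * i ^ 2) ^ 2 - x ^ 2); [nra|].
    replace ((x + C * i ^ 2) ^ 2 - x ^ 2) with (2 * C * i * (i * x) + C ^ 2 * i ^ 4) by ring.
    rewrite ix. nra.
  - apply is_lim_const.
  - apply is_lim_scal_inv.
Qed.

Lemma phi1_lt1 (x : R) : phi1 x < 1.
Proof.
  (* Passing to [x + 1] turns the weak bound by the limit into a strict one. If it failed there,
     [phi1] would exceed one by a fixed amount at all later points, against [phi1_bounds] at a large
     [z]. *)
  apply Rlt_le_trans with (phi1 (x + 1)); [apply phi1_incr; lra|].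
  apply Rnot_lt_le. intros hlt. pose proof phi0_pos.
  set (C := 4 / 3 * phi 0).
  set (z := Rmax (x + 2) (Rmax 1 (C / (phi1 (x + 1) - 1)))).
  assert (x + 2 <= z) by apply Rmax_l.
  assert (1 <= z) by (eapply Rle_trans; [apply Rmax_l|apply Rmax_r]).
  assert (C / (phi1 (x + 1) - 1) <= z) by (eapply Rle_trans; [apply Rmax_r|apply Rmax_r]).
  apply Rle_div_l in H2; [|lra].
  pose proof (phi1_bounds z H1) as [_ hb]. fold C in hb.
  pose proof (phi1_incr (x + 1) z ltac:(lra)).
  assert (C / z <= phi1 (x + 1) - 1) by (apply Rle_div_l; lra). lra.
Qed.

Lemma phi1_abs (x : R) : -1 < phi1 x < 1.
Proof.
  split; [|apply phi1_lt1]. pose proof (phi1_lt1 (- x)) as h. rewrite phi1_odd in h. lra.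
Qed.
End SelfSimilar.

(** * Invariance of the flow from [Rabs] under parabolic scaling and reflection *)

Lemma scaled_diff_lt (k l d x y : R) :
  0 < k -> 0 < d -> Rabs l <= k -> Rabs (y - x) < d / k -> Rabs (l * y - l * x) < d.
Proof.
  intros hk hd hl hxy. rewrite <- Rmult_minus_distr_l, Rabs_mult.
  apply Rle_lt_trans with (k * Rabs (y - x)).
  - apply Rmult_le_compat_r; [apply Rabs_pos|exact hl].
  - rewrite Rmult_comm. now apply Rlt_div_r.
Qed.

Lemma continuity_2d_pt_rescale (f : R -> R -> R) (c l m x t : R) :
  continuity_2d_pt f (l * x) (m * t) ->
  continuity_2d_pt (fun x t => c * f (l * x) (m * t)) x t.
Proof.
  intros Hf. apply continuity_2d_pt_mult; [apply continuity_2d_pt_const|].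
  intros eps. destruct (Hf eps) as [d Hd].
  set (k := 1 + Rabs l + Rabs m). pose proof (Rabs_pos l). pose proof (Rabs_pos m).
  assert (hk : 0 < k) by (unfold k; lra).
  assert (hd : 0 < d / k) by (apply Rdiv_lt_0_compat; [apply cond_pos|exact hk]).
  exists (mkposreal _ hd). simpl. intros u v hu hv.
  apply Hd; apply (scaled_diff_lt k); try apply cond_pos; auto; unfold k; lra.
Qed.

(** The induction is over all [f] and [c], since a partial derivative of the rescaled function is
    again of this form, with constant [c * l] or [c * m]. *)
Lemma ex_diff_n_rescale (l m : R) (n : nat) :
  0 < m -> forall (f : R -> R -> R) (c : R),
  (forall x t, 0 < t -> ex_diff_n f n x t) ->
  forall x t, 0 < t -> ex_diff_n (fun x t => c * f (l * x) (m * t)) n x t.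
Proof.
  intros hm. induction n as [|n IH]; intros f c Hf x t ht;
    assert (mt : forall s, 0 < s -> 0 < m * s) by (intros s hs; now apply Rmult_lt_0_compat).
  - split; [|exact I]. apply continuity_2d_pt_rescale. now apply (Hf (l * x) (m * t)), mt.
  - assert (D1 : forall u v, 0 < v ->
      is_derive (fun z => c * f (l * z) (m * v)) u
        (c * l * Derive (fun z => f z (m * v)) (l * u))).
    { intros u v hv. destruct (Hf (l * u) (m * v) (mt v hv)) as (_ & e1 & _ & _).
      auto_derive; [exact e1|]. change (fun x => f x (m * v)) with (fun z => f z (m * v)). ring. }
    assert (D2 : forall u v, 0 < v ->
      is_derive (fun z => c * f (l * u) (m * z)) v
        (c * m * Derive (fun z => f (l * u) z) (m * v))).
    { intros u v hv. destruct (Hf (l * u) (m * v) (mt v hv)) as (_ & _ & e2 & _).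
      auto_derive; [exact e2|]. change (fun x => f (l * u) x) with (fun z => f (l * u) z). ring. }
    split; [|split; [|split; [|split]]].
    + apply continuity_2d_pt_rescale. now apply (Hf (l * x) (m * t)), mt.
    + eexists. now apply D1.
    + eexists. now apply D2.
    + apply (ex_diff_n_ext_loc
        (fun u v => c * l * (fun u v => Derive (fun z => f z v) u) (l * u) (m * v))).
      (* The radius [t] keeps the times [v] positive. *)
      * exists (mkposreal t ht). simpl. intros u v _ hv. apply Rabs_def2 in hv.
        symmetry. apply is_derive_unique, D1. lra.
      * apply (IH (fun u v => Derive (fun z => f z v) u)); [|exact ht].
        intros u v hv. now apply (Hf u v hv).
    + apply (ex_diff_n_ext_loc
        (fun u v => c * m * (fun u v => Derive (fun z => f u z) v) (l * u) (m * v))).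
      * exists (mkposreal t ht). simpl. intros u v _ hv. apply Rabs_def2 in hv.
        symmetry. apply is_derive_unique, D2. lra.
      * apply (IH (fun u v => Derive (fun z => f u z) v)); [|exact ht].
        intros u v hv. now apply (Hf u v hv).
Qed.

Lemma smooth_derivatives (T : Rbar) (y : R -> R -> R) (x t : R) :
  smooth_on_strip T y -> 0 < t -> Rbar_lt t T ->
  continuity_2d_pt y x t /\
  is_derive (fun z => y z t) x (dx y x t) /\
  is_derive (fun z => dx y z t) x (dxx y x t) /\
  is_derive (fun s => y x s) t (dt y x t).
Proof.
  intros Hy ht hT. destruct (Hy x t ht hT 2%nat) as (hc & h1 & h2 & (_ & h3 & _) & _).
  split; [exact hc|]. split; [now apply Derive_correct|].
  split; [now apply Derive_correct|now apply Derive_correct].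
Qed.

Lemma csf_from_abs_rescale (l : R) (u : R -> R -> R) :
  l <> 0 -> csf_from Rabs u ->
  csf_from Rabs (fun x t => / Rabs l * u (l * x) (l ^ 2 * t)).
Proof.
  intros hl (Hc & [Hs Hpde] & Hu & H0).
  pose proof (Rabs_pos_lt l hl) as al.
  assert (hm : 0 < l ^ 2) by (rewrite <- pow2_abs; now apply pow_lt).
  set (k := 1 + Rabs l + Rabs (l ^ 2)). pose proof (Rabs_pos (l ^ 2)).
  assert (hk : 0 < k) by (unfold k; lra).
  assert (kl : Rabs l <= k) by (unfold k; lra).
  assert (km : Rabs (l ^ 2) <= k) by (unfold k; lra).
  set (w := fun x t => / Rabs l * u (l * x) (l ^ 2 * t)).
  repeat split.
  - intros [x t] hxt. simpl in hxt.
    apply (filterlim_comp _ _ _ (fun p => u (l * fst p) (l ^ 2 * snd p))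
      (fun z => / Rabs l * z) _ (locally (u (l * x) (l ^ 2 * t)))).
    + intros P HP.
      assert (hp : 0 <= l ^ 2 * t) by (apply Rmult_le_pos; lra).
      destruct (Hc (l * x, l ^ 2 * t) hp P HP) as [d Hd].
      assert (hd : 0 < d / k) by (apply Rdiv_lt_0_compat; [apply cond_pos|exact hk]).
      exists (mkposreal _ hd). intros [x' t'] [hx ht'] hq. simpl in hx, ht', hq.
      apply (Hd (l * x', l ^ 2 * t')).
      * split; apply (scaled_diff_lt k); auto; apply cond_pos.
      * simpl. simpl in hq. apply Rmult_le_pos; lra.
    + apply (filterlim_scal_r (/ Rabs l) (u (l * x) (l ^ 2 * t))).
  - intros x t ht _ n. apply (ex_diff_n_rescale l (l ^ 2) n hm u); [|exact ht].
    intros x' t' ht'. now apply Hs.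
  - intros x t ht hT.
    assert (mt : forall s, 0 < s -> 0 < l ^ 2 * s) by (intros s hs; now apply Rmult_lt_0_compat).
    assert (D1 : forall z, is_derive (fun z => w z t) z (/ Rabs l * l * dx u (l * z) (l ^ 2 * t))).
    { intros z. destruct (smooth_derivatives _ _ (l * z) _ Hs (mt t ht) I) as (_ & h & _).
      unfold w. auto_derive; [eexists; eassumption|]. rewrite_derive. ring. }
    assert (E1 : forall z, dx w z t = / Rabs l * l * dx u (l * z) (l ^ 2 * t)).
    { intros z. apply is_derive_unique, D1. }
    assert (E2 : dxx w x t = / Rabs l * l ^ 2 * dxx u (l * x) (l ^ 2 * t)).
    { change (dxx w x t) with (Derive (fun z => dx w z t) x). rewrite (Derive_ext _ _ _ E1). apply is_derive_unique.
      destruct (smooth_derivatives _ _ (l * x) _ Hs (mt t ht) I) as (_ & _ & h & _).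
      auto_derive; [eexists; eassumption|]. rewrite_derive. ring. }
    assert (E3 : dt w x t = / Rabs l * l ^ 2 * dt u (l * x) (l ^ 2 * t)).
    { apply is_derive_unique.
      destruct (smooth_derivatives _ _ (l * x) _ Hs (mt t ht) I) as (_ & _ & _ & h).
      unfold w. auto_derive; [eexists; eassumption|]. rewrite_derive. ring. }
    fold w. rewrite E1, E2, E3, Hpde by (auto; exact I).
    (* The factor [/ Rabs l * l] is the sign of [l], so the squared slope is unchanged. *)
    replace ((/ Rabs l * l * dx u (l * x) (l ^ 2 * t)) ^ 2)
      with (dx u (l * x) (l ^ 2 * t) ^ 2).
    2: { rewrite !Rpow_mult_distr, pow_inv, pow2_abs. field. exact hl. }
    pose proof (pow2_ge_0 (dx u (l * x) (l ^ 2 * t))). field. lra.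
  - intros K eps heps.
    destruct (Hu (Rabs l * K) (Rabs l * eps)) as [d Hd]; [now apply Rmult_lt_0_compat|].
    assert (hd : 0 < d / k) by (apply Rdiv_lt_0_compat; [apply cond_pos|exact hk]).
    exists (mkposreal _ hd). intros t ht t0 x hx.
    assert (Rabs (u (l * x) (l ^ 2 * t) - Rabs (l * x)) < Rabs l * eps).
    { apply Hd.
      - pose proof (scaled_diff_lt k (l ^ 2) d 0 t hk (cond_pos d) km ht) as h.
        rewrite Rmult_0_r in h. exact h.
      - now apply Rmult_lt_0_compat.
      - rewrite Rabs_mult. apply Rmult_le_compat_l; lra. }
    apply (Rmult_lt_reg_l (Rabs l)); [exact al|].
    rewrite <- (Rabs_Rabsolu l) at 1. rewrite <- Rabs_mult.
    rewrite Rabs_mult in H1.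
    unfold w. replace (Rabs l * (/ Rabs l * u (l * x) (l ^ 2 * t) - Rabs x))
      with (u (l * x) (l ^ 2 * t) - Rabs l * Rabs x) by (field; lra).
    exact H1.
  - intros x. unfold w. rewrite Rmult_0_r, H0, Rabs_mult. field. lra.
Qed.

(** * Symmetry, equation and growth of the time-one slice *)

Section FlowFromAbs.
Variable u : R -> R -> R.
Hypothesis Hu : the_csf_from Rabs u.

Lemma flow_even (x t : R) : 0 <= t -> u (- x) t = u x t.
Proof.
  intros ht. rewrite <- (proj2 Hu _ (csf_from_abs_rescale (-1) u ltac:(lra) (proj1 Hu)) x t ht).
  rewrite Rabs_left by lra. replace (-1 * x) with (- x) by ring.
  replace ((-1) ^ 2 * t) with t by ring. field.
Qed.

Lemma flow_self_similar (x t : R) : 0 < t -> u x t = sqrt t * u (x / sqrt t) 1.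
Proof.
  intros ht. pose proof (sqrt_lt_R0 t ht) as st.
  assert (hl : 0 < / sqrt t) by now apply Rinv_0_lt_compat.
  rewrite <- (proj2 Hu _ (csf_from_abs_rescale (/ sqrt t) u ltac:(lra) (proj1 Hu)) x t ltac:(lra)).
  rewrite Rabs_right, Rinv_inv by lra. f_equal. f_equal.
  - unfold Rdiv. ring.
  - rewrite pow_inv, pow2_sqrt by lra. field. lra.
Qed.

Lemma profile_derivatives (x : R) :
  is_derive (fun z => u z 1) x (dx u x 1) /\ is_derive (fun z => dx u z 1) x (dxx u x 1).
Proof.
  destruct Hu as [(_ & [Hs _] & _) _].
  destruct (smooth_derivatives _ _ x 1 Hs Rlt_0_1 I) as (_ & h1 & h2 & _). now split.
Qed.

(** Differentiating [sqrt s * u (x / sqrt s) 1] at [s = 1] expresses [dt u] through the slice alone;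
    the flow equation then gives [dxx u]. *)
Lemma profile_ode (x : R) :
  dxx u x 1 = 1 / 2 * (1 + dx u x 1 ^ 2) * (u x 1 - x * dx u x 1).
Proof.
  assert (E : dt u x 1 = 1 / 2 * (u x 1 - x * dx u x 1)).
  { apply is_derive_unique.
    apply (is_derive_ext_loc (fun s => sqrt s * u (x / sqrt s) 1)).
    - exists (mkposreal 1 Rlt_0_1). intros s hs. symmetry. apply flow_self_similar.
      unfold ball in hs. simpl in hs. unfold AbsRing_ball, abs, minus, plus, opp in hs.
      simpl in hs. apply Rabs_def2 in hs. lra.
    - destruct (profile_derivatives (x * / sqrt 1)) as [h _].
      auto_derive; [repeat split; try lra; [eexists; eassumption|rewrite sqrt_1; lra]|].
      rewrite_derive. rewrite sqrt_1. unfold Rdiv. rewrite Rinv_1, !Rmult_1_r. field. }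
  destruct Hu as [(_ & [_ Hpde] & _) _].
  rewrite Hpde in E by (try exact I; lra).
  pose proof (pow2_ge_0 (dx u x 1)).
  rewrite (Rmult_comm (1 / 2)), Rmult_assoc, <- E. field. lra.
Qed.

(** Self-similarity turns the initial condition into growth at infinity:
    [u 1 (/ x ^ 2) = u x 1 / x], and the left side tends to one. *)
Lemma profile_asymp (eps : R) : 0 < eps ->
  exists M, 0 < M /\ forall x, M <= x -> Rabs (u x 1 - x) <= eps * x.
Proof.
  intros heps. destruct Hu as [(_ & _ & Hl & _) _].
  destruct (Hl 1 eps heps) as [d Hd].
  pose proof (Rinv_0_lt_compat d (cond_pos d)) as id.
  exists (1 + / d). split; [lra|]. intros x hx.
  assert (ix : 0 < / x) by (apply Rinv_0_lt_compat; lra).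
  assert (h2 : 0 < / x ^ 2) by (apply Rinv_0_lt_compat, pow_lt; lra).
  assert (hs : sqrt (/ x ^ 2) = / x) by (rewrite <- pow_inv; apply sqrt_pow2; lra).
  assert (Rabs (u 1 (/ x ^ 2) - Rabs 1) < eps) as h.
  { apply Hd; [|exact h2|rewrite Rabs_R1; lra].
    unfold ball. simpl. unfold AbsRing_ball, abs, minus, plus, opp. simpl.
    rewrite Ropp_0, Rplus_0_r. change (x * (x * 1)) with (x ^ 2). rewrite Rabs_right by lra.
    rewrite <- (Rinv_inv d). apply Rinv_lt_contravar; [|nra].
    apply Rmult_lt_0_compat; [lra|apply pow_lt; lra]. }
  rewrite Rabs_R1, (flow_self_similar 1) in h by exact h2.
  rewrite hs in h. replace (1 / / x) with x in h by (field; lra).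
  apply Rlt_le. replace (u x 1 - x) with ((/ x * u x 1 - 1) * x) by (field; lra).
  rewrite Rabs_mult, (Rabs_right x) by lra. apply Rmult_lt_compat_r; lra.
Qed.
End FlowFromAbs.

(** * The rotated profile: equation of [W], its integral, and [calA0] as an angle *)

Section Rotated.
Variables phi phi1 phi2 W : R -> R.
Hypothesis phi_derive : forall x, is_derive phi x (phi1 x).
Hypothesis phi1_derive : forall x, is_derive phi1 x (phi2 x).
Hypothesis phi_ode : forall x, phi2 x = 1 / 2 * (1 + phi1 x ^ 2) * (phi x - x * phi1 x).
Hypothesis phi_even : forall x, phi (- x) = phi x.
Hypothesis phi_asymp :
  forall eps, 0 < eps -> exists M, 0 < M /\ forall x, M <= x -> Rabs (phi x - x) <= eps * x.
Hypothesis W_surj : forall x, 0 < x ->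
  exists a, x = (a + phi a) / sqrt 2 /\ W x = (phi a - a) / sqrt 2.
Hypothesis W_graph : forall a,
  0 < (a + phi a) / sqrt 2 /\ W ((a + phi a) / sqrt 2) = (phi a - a) / sqrt 2.
Hypothesis W_pos : forall x, 0 < x -> 0 < W x.

(* The rotation sends [(a, phi a)] to the point of the graph of [W] with abscissa
   [X a]; [A] recovers the parameter [a] from the abscissa. *)
Let X (a : R) : R := (a + phi a) / sqrt 2.
Let A (x : R) : R := (x - W x) / sqrt 2.
(** The rotation subtracts [PI / 4] from the tangent angle; this is the tangent of the
    difference. *)
Let W1 (x : R) : R := (phi1 (A x) - 1) / (phi1 (A x) + 1).
(** Taken to be the right side of the self-similar equation, so that the equation holds by
    reflexivity and its content lies in [W1_derive]. *)
Let W2 (x : R) : R := 1 / 2 * (1 + W1 x ^ 2) * (W x - x * W1 x).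

Let phi1_abs' : forall x, -1 < phi1 x < 1 :=
  phi1_abs phi phi1 phi2 phi_derive phi1_derive phi_ode phi_even phi_asymp.

Lemma sqrt2_pos_sqr : 0 < sqrt 2 /\ sqrt 2 * sqrt 2 = 2.
Proof. split; [apply sqrt_lt_R0; lra|apply sqrt_sqrt; lra]. Qed.

Lemma param_spec (x : R) : 0 < x -> X (A x) = x /\ W x = (phi (A x) - A x) / sqrt 2.
Proof.
  intros hx. destruct (W_surj x hx) as (a & ha & hw). destruct sqrt2_pos_sqr as [s0 s2].
  assert (A x = a) as ->.
  { unfold A. rewrite hw. rewrite ha at 1.
    transitivity (2 * a / (sqrt 2 * sqrt 2)); [field; lra|rewrite s2; field]. }
  now split.
Qed.

Lemma param_abscissa (a : R) : A (X a) = a.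
Proof.
  destruct sqrt2_pos_sqr as [s0 s2]. unfold A, X. rewrite (proj2 (W_graph a)).
  transitivity (2 * a / (sqrt 2 * sqrt 2)); [field; lra|rewrite s2; field].
Qed.

Lemma abscissa_derive (a : R) : is_derive X a ((1 + phi1 a) / sqrt 2).
Proof.
  pose proof (phi_derive a). destruct sqrt2_pos_sqr as [s0 _]. unfold X.
  auto_derive; [eexists; eassumption|]. rewrite_derive. field. lra.
Qed.

Lemma abscissa_incr (a b : R) : a < b -> X a < X b.
Proof.
  intros hab. destruct sqrt2_pos_sqr as [s0 _].
  apply (incr_function X m_infty p_infty (fun a => (1 + phi1 a) / sqrt 2)); try easy.
  - intros x _ _. apply abscissa_derive.
  - intros x _ _. apply Rdiv_lt_0_compat; [|easy]. pose proof (phi1_abs' x). lra.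
Qed.

Lemma param_lt (x a : R) : 0 < x -> x < X a -> A x < a.
Proof.
  intros hx h. apply Rnot_le_lt. intros [hlt|heq].
  - apply abscissa_incr in hlt. rewrite (proj1 (param_spec x hx)) in hlt. lra.
  - rewrite heq, (proj1 (param_spec x hx)) in h. lra.
Qed.

Lemma param_gt (x a : R) : 0 < x -> X a < x -> a < A x.
Proof.
  intros hx h. apply Rnot_le_lt. intros [hlt|heq].
  - apply abscissa_incr in hlt. rewrite (proj1 (param_spec x hx)) in hlt. lra.
  - rewrite <- heq, (proj1 (param_spec x hx)) in h. lra.
Qed.

Lemma param_continuous (x : R) : 0 < x -> continuity_pt A x.
Proof.
  intros hx eps heps. pose proof (proj1 (param_spec x hx)) as hX.
  pose proof (abscissa_incr (A x) (A x + eps) ltac:(lra)) as h1. rewrite hX in h1.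
  pose proof (abscissa_incr (A x - eps) (A x) ltac:(lra)) as h2. rewrite hX in h2.
  exists (Rmin x (Rmin (X (A x + eps) - x) (x - X (A x - eps)))).
  split; [repeat apply Rmin_glb_lt; lra|].
  intros y [_ hy]. simpl in *. unfold Rdist in *. apply Rabs_def2 in hy.
  pose proof (Rmin_l x (Rmin (X (A x + eps) - x) (x - X (A x - eps)))).
  pose proof (Rmin_r x (Rmin (X (A x + eps) - x) (x - X (A x - eps)))).
  pose proof (Rmin_l (X (A x + eps) - x) (x - X (A x - eps))).
  pose proof (Rmin_r (X (A x + eps) - x) (x - X (A x - eps))).
  assert (A y < A x + eps) by (apply param_lt; lra).
  assert (A x - eps < A y) by (apply param_gt; lra).
  apply Rabs_def1; lra.
Qed.

Lemma param_derive (x : R) : 0 < x -> is_derive A x (sqrt 2 / (1 + phi1 (A x))).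
Proof.
  intros hx. destruct sqrt2_pos_sqr as [s0 _]. pose proof (phi1_abs' (A x)).
  assert (Hmono : forall y z, 0 < y -> y < z -> A y <= A z).
  { intros y z hy hyz. apply Rlt_le, param_lt; [easy|]. now rewrite (proj1 (param_spec z ltac:(lra))). }
  (* The derivability proof is given explicitly so that [derive_pt] computes to the known derivative
     of [X]. *)
  set (Prf := fun a (_ : A (x / 2) <= a <= A (2 * x)) =>
    exist (fun l => derivable_pt_abs X a l) _ (proj1 (is_derive_Reals _ _ _) (abscissa_derive a))
    : derivable_pt X a).
  assert (Hx : A (x / 2) <= A x <= A (2 * x)) by (split; apply Hmono; lra).
  apply is_derive_Reals.
  replace (sqrt 2 / (1 + phi1 (A x))) with (1 / derive_pt X (A x) (Prf (A x) Hx)).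
  2: { simpl. field. lra. }
  apply (derivable_pt_lim_recip_interv X A (x / 2) (2 * x) x Prf (param_continuous x hx)); try lra.
  - intros y hy. unfold comp, id. apply param_spec. lra.
  - simpl. apply Rgt_not_eq, Rdiv_lt_0_compat; lra.
Qed.

Lemma W_derive (x : R) : 0 < x -> is_derive W x (W1 x).
Proof.
  intros hx. destruct sqrt2_pos_sqr as [s0 s2]. pose proof (phi1_abs' (A x)).
  apply (is_derive_ext (fun x => x - sqrt 2 * A x)).
  { intros y. unfold A. simpl. field. lra. }
  pose proof (param_derive x hx). auto_derive; [eexists; eassumption|]. rewrite_derive.
  unfold W1. transitivity (1 - (sqrt 2 * sqrt 2) / (1 + phi1 (A x))); [field; lra|].
  rewrite s2. field. lra.
Qed.

(** Both intercepts measure the distance from the origin to the same tangent line, which the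
    rotation preserves; the factor converts between the two slopes. *)
Lemma W_intercept_eq (x : R) : 0 < x ->
  W x - x * W1 x = sqrt 2 / (1 + phi1 (A x)) * (phi (A x) - A x * phi1 (A x)).
Proof.
  intros hx. destruct (param_spec x hx) as [h1 h2]. destruct sqrt2_pos_sqr as [s0 s2].
  pose proof (phi1_abs' (A x)). unfold W1. rewrite h2. rewrite <- h1 at 3. unfold X.
  apply (Rmult_eq_reg_r (sqrt 2)); [|lra].
  transitivity (sqrt 2 * sqrt 2 / (1 + phi1 (A x)) * (phi (A x) - A x * phi1 (A x)));
    [rewrite s2; field; lra|field; lra].
Qed.

Lemma W1_derive (x : R) : 0 < x -> is_derive W1 x (W2 x).
Proof.
  intros hx. pose proof (phi1_abs' (A x)). destruct sqrt2_pos_sqr as [s0 s2].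
  pose proof (param_derive x hx). pose proof (phi1_derive (A x)).
  unfold W2. rewrite W_intercept_eq by easy. unfold W1.
  auto_derive; [repeat split; try (eexists; eassumption); lra|].
  rewrite_derive. rewrite phi_ode. field. lra.
Qed.

Lemma W1_neg (x : R) : 0 < x -> W1 x < 0.
Proof.
  intros hx. pose proof (phi1_abs' (A x)). unfold W1.
  assert (0 < (1 - phi1 (A x)) / (phi1 (A x) + 1)) by (apply Rdiv_lt_0_compat; lra).
  replace ((phi1 (A x) - 1) / (phi1 (A x) + 1))
    with (- ((1 - phi1 (A x)) / (phi1 (A x) + 1))) by (field; lra). lra.
Qed.

(** A primitive of [W]: the tangent angle has derivative [1 / 2 * (W x - x * W1 x)] by the
    self-similar equation, and the product term contributes [1 / 2 * (W x + x * W1 x)]. *)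
Let F (x : R) : R := atan (phi1 (A x)) + 1 / 2 * x * W x.

Lemma W_primitive_derive (x : R) : 0 < x -> is_derive F x (W x).
Proof.
  intros hx. pose proof (phi1_abs' (A x)). destruct sqrt2_pos_sqr as [s0 s2].
  pose proof (param_derive x hx). pose proof (phi1_derive (A x)). pose proof (W_derive x hx).
  pose proof (W_intercept_eq x hx) as E.
  unfold F. auto_derive; [repeat split; eexists; eassumption|].
  rewrite_derive. rewrite phi_ode.
  set (p := phi1 (A x)) in *. set (g := phi (A x) - A x * p) in *.
  pose proof (pow2_ge_0 p).
  transitivity (1 / 2 * (sqrt 2 / (1 + p) * g) + 1 / 2 * (W x + x * W1 x)).
  - unfold Rsqr. field. lra.
  - rewrite <- E. field.
Qed.

Lemma param_lim : is_lim A p_infty p_infty.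
Proof.
  intros P [M HM]. exists (Rmax 0 (X M)). intros x hx.
  pose proof (Rmax_l 0 (X M)). pose proof (Rmax_r 0 (X M)).
  apply HM, param_gt; lra.
Qed.

(** The angle tends to [atan 1], and in the parameter [A x] the product term is a quarter of
    [phi ^ 2 - a ^ 2], which vanishes at infinity. *)
Lemma W_primitive_lim : is_lim F p_infty (PI / 4).
Proof.
  destruct sqrt2_pos_sqr as [s0 s2].
  apply (is_lim_ext_loc (fun x => atan (phi1 (A x)) + 1 / 4 * (phi (A x) ^ 2 - A x ^ 2))).
  { exists 0. intros x hx. unfold F. destruct (param_spec x hx) as [h1 h2].
    rewrite h2. rewrite <- h1 at 5. unfold X. f_equal.
    transitivity (1 / 2 * (phi (A x) ^ 2 - A x ^ 2) / (sqrt 2 * sqrt 2)).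
    - rewrite s2. field.
    - field. lra. }
  replace (PI / 4) with (atan 1 + 1 / 4 * 0) by (rewrite atan_1; ring).
  apply is_lim_plus'.
  - apply (filterlim_comp _ _ _ (fun x => phi1 (A x)) atan _ (locally 1)).
    + apply (filterlim_comp _ _ _ A phi1 _ (Rbar_locally p_infty)); [exact param_lim|].
      exact (phi1_lim phi phi1 phi2 phi_derive phi1_derive phi_ode phi_even phi_asymp).
    + apply (ex_derive_continuous atan 1). eexists. apply is_derive_atan.
  - apply (is_lim_scal_l (fun x => phi (A x) ^ 2 - A x ^ 2) (1 / 4) p_infty 0).
    apply (filterlim_comp _ _ _ A (fun a => phi a ^ 2 - a ^ 2) _ (Rbar_locally p_infty));
      [exact param_lim|].
    exact (phi_sqr_lim phi phi1 phi2 phi_derive phi1_derive phi_ode phi_even phi_asymp).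
Qed.

Lemma sigma_W_eq (x : R) : 0 < x -> sigma_W W x = PI / 4 - F x.
Proof.
  intros hx.
  assert (HD : forall z, 0 < z -> Derive F z = W z).
  { intros z hz. now apply is_derive_unique, W_primitive_derive. }
  assert (Hf : forall P : R -> Prop, (forall z, 0 < z -> P z) ->
    filter_prod (at_point x) (Rbar_locally p_infty) (fun ab =>
      forall z, Rmin (fst ab) (snd ab) <= z <= Rmax (fst ab) (snd ab) -> P z)).
  { intros P HP. apply (Filter_prod _ _ _ (fun a => a = x) (fun b => x < b)).
    - now unfold at_point.
    - now exists x.
    - intros a b -> hb z. simpl. rewrite Rmin_left, Rmax_right by lra. intros hz.
      apply HP. lra. }
  apply is_RInt_gen_unique.
  (* [Derive F] is known to equal [W] only at positive arguments; with lower end [x] and upper end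
     beyond it, the interval of integration stays there. *)
  apply (is_RInt_gen_ext (Derive F)).
  { apply (filter_imp (fun ab =>
      forall z, Rmin (fst ab) (snd ab) <= z <= Rmax (fst ab) (snd ab) -> Derive F z = W z)).
    - intros ab h z hz. apply h. lra.
    - now apply Hf. }
  apply is_RInt_gen_Derive.
  - apply Hf. intros z hz. eexists. now apply W_primitive_derive.
  - apply Hf. intros z hz. apply (continuous_ext_loc _ W).
    + exists (mkposreal z hz). intros w hw. symmetry. apply HD.
      unfold ball in hw. simpl in hw. unfold AbsRing_ball, abs, minus, plus, opp in hw.
      simpl in hw. apply Rabs_def2 in hw. lra.
    + apply (ex_derive_continuous W). eexists. now apply W_derive.
  - intros P HP. unfold filtermap, at_point. now apply locally_singleton.
  - exact W_primitive_lim.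
Qed.

(** The product [1 / 2 * x * W x] in [calA0] cancels the one in [F], so only the tangent angle
    remains. *)
Lemma calA0_angle (x : R) : 0 < x -> calA0 W x = PI / 4 - atan (phi1 (A x)).
Proof.
  intros hx. unfold calA0. rewrite sigma_W_eq by easy. unfold F. ring.
Qed.

Lemma calA0_range (x : R) : 0 < x -> 0 < calA0 W x < PI / 2.
Proof.
  intros hx. rewrite calA0_angle by easy. pose proof (phi1_abs' (A x)) as [h1 h2].
  replace (-1) with (- (1)) in h1 by ring.
  apply atan_increasing in h1, h2. rewrite atan_opp in h1. rewrite atan_1 in *. lra.
Qed.

Lemma tan_calA0 (x : R) : 0 < x -> tan (calA0 W x) = - W1 x.
Proof.
  intros hx. pose proof (calA0_range x hx) as hr. revert hr. rewrite calA0_angle by easy. intros hr.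
  pose proof (phi1_abs' (A x)) as [h1 h2]. pose proof (atan_bound (phi1 (A x))).
  rewrite tan_minus.
  - rewrite tan_PI4, tan_atan. unfold W1. field. lra.
  - apply Rgt_not_eq, cos_gt_0; lra.
  - apply Rgt_not_eq, cos_gt_0; lra.
  - apply Rgt_not_eq, cos_gt_0; lra.
  - rewrite tan_PI4, tan_atan. lra.
Qed.

(** Replacing the parameter [a] by [- a] swaps abscissa and ordinate in the rotated frame, so
    [A (W x) = - A x]; oddness of [phi1] then flips the sign of the angle. *)
Lemma calA0_W (x : R) : 0 < x -> calA0 W (W x) = calA1 W x.
Proof.
  intros hx. pose proof (param_spec x hx) as [h1 h2]. unfold calA1.
  rewrite !calA0_angle; [|easy|now apply W_pos].
  assert (A (W x) = - A x) as ->.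
  { rewrite <- (param_abscissa (- A x)). f_equal. unfold X. rewrite phi_even, h2. f_equal. ring. }
  rewrite (phi1_odd phi phi1 phi_derive phi_even), atan_opp. field.
Qed.

Lemma gradient_estimate_of_profile (T : R) (y : R -> R -> R) :
  (forall x t, 0 < t < T -> 0 < y x t) -> graphical_csf T y ->
  forall t x, 0 < t < T ->
    Rabs (dx y x t) <= 1 / tan (calA0 W (y x t / sqrt t)) /\
    1 / tan (calA0 W (y x t / sqrt t)) = tan (calA1 W (y x t / sqrt t)) /\
    tan (calA1 W (y x t / sqrt t)) = tan (calA0 W (W (y x t / sqrt t))).
Proof.
  intros hpos [Hs Hpde] t x ht.
  set (Y := y x t / sqrt t).
  assert (hY : 0 < Y) by (apply Rdiv_lt_0_compat; [auto|apply sqrt_lt_R0; lra]).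
  split; [|split].
  - rewrite tan_calA0 by easy. pose proof (W1_neg Y hY). apply Rle_div_r; [lra|].
    assert (Hd := fun x t (h : 0 < t < T) => smooth_derivatives T y x t Hs (proj1 h) (proj2 h)).
    apply (gradient_bound W W1 W2 W_pos W_derive W1_derive W1_neg (fun x _ => eq_refl) T y
      (dx y) (dxx y) (dt y)); auto; try (intros; now apply Hd).
    intros x' t' [h1 h2]. now apply Hpde.
  - pose proof (calA0_range Y hY). unfold calA1, tan. rewrite sin_shift, cos_shift.
    assert (0 < sin (calA0 W Y)) by (apply sin_gt_0; lra).
    assert (0 < cos (calA0 W Y)) by (apply cos_gt_0; lra).
    field. lra.
  - now rewrite calA0_W.
Qed.
End Rotated.

Theorem theorem1p3 (W : R -> R) (hW : is_W W)
  (T : R) (hT : 0 < T) (y : R -> R -> R)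
  (hpos : forall x t : R, 0 < t < T -> 0 < y x t)
  (hy : graphical_csf T y) :
  forall t x : R, 0 < t < T ->
    Rabs (dx y x t) <= 1 / tan (calA0 W (y x t / sqrt t)) /\
    1 / tan (calA0 W (y x t / sqrt t)) = tan (calA1 W (y x t / sqrt t)) /\
    tan (calA1 W (y x t / sqrt t)) = tan (calA0 W (W (y x t / sqrt t))).
Proof.
  destruct hW as [W_pos (u & Hu & HW)].
  assert (Hrot : forall a, rotate_clockwise (PI / 4) (a, u a 1) =
    ((a + u a 1) / sqrt 2, (u a 1 - a) / sqrt 2)).
  { intros a. unfold rotate_clockwise. simpl. rewrite cos_PI4, sin_PI4.
    pose proof sqrt2_pos_sqr as [s0 _]. f_equal; field; lra. }
  apply (gradient_estimate_of_profile (fun x => u x 1) (fun x => dx u x 1) (fun x => dxx u x 1) W);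
    auto.
  - intros x. now apply profile_derivatives.
  - intros x. now apply profile_derivatives.
  - intros x. now apply profile_ode.
  - intros x. apply flow_even; [exact Hu|lra].
  - now apply profile_asymp.
  (* The two directions of the equivalence in [is_W] say that every point of the graph of [W] has a
     parameter, and that every parameter gives a point of the graph. *)
  - intros x hx. destruct (proj1 (HW (x, W x)) (conj hx eq_refl)) as [a ha].
    exists a. rewrite Hrot in ha. now injection ha.
  - intros a. destruct (proj2 (HW ((a + u a 1) / sqrt 2, (u a 1 - a) / sqrt 2))) as [h1 h2].
    { exists a. now rewrite Hrot. }
    now split.
Qed.
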